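(* Let $d\ge1$, $k,l\in\{1,\dots,d\}$, $\sigma\in\mathbb N_{\ge d+1}$, $p_1,\dots,p_k,\tilde p_1,\dots,\tilde p_l\in\mathbb C$ with $\sum_{i=1}^k|p_i|^2=\sum_{j=1}^l|\tilde p_j|^2<1$, and put $|p_0|^2=1-\sum_{i=1}^k|p_i|^2$. Let $U$ be a complex $d\times d$ matrix such that $$\hat U^\dagger C\hat U\widetilde C=|p_0|^2I_{d+1},$$ where $$\hat U=\begin{pmatrix}1&\mathbf 1_l^t\\ \mathbf 1_k&U\end{pmatrix},\quad C=\mathrm{diag}(1,-|p_1|^2,\dots,-|p_k|^2,-|p_0|^2,\dots,-|p_0|^2),\quad \widetilde C=\mathrm{diag}(1,-|\tilde p_1|^2,\dots,-|\tilde p_l|^2,-|p_0|^2,\dots,-|p_0|^2)$$ are $(d+1)\times(d+1)$ matrices. Let $a\in\mathbb C$ with $|a|^{-2}=|p_0|^2$ and set $p_i=\frac1a$ for $k+1\le i\le d$, $\tilde p_j=\frac1a$ for $l+1\le j\le d$, $\mathbf p=(p_1,\dots,p_d)$, $\tilde{\mathbf p}=(\tilde p_1,\dots,\tilde p_d)$. Then the degenerate Meixner polynomials $\hat M_{\mathbf m}(\mathbf n)=\hat M_{\mathbf m}(\mathbf n;U,\sigma)$, $\mathbf m,\mathbf n\in\mathbb N_0^d$ (with respect to the pair $(k,l)$) have the following properties. (i) Orthogonality relations: $$\sum_{\mathbf n\in\mathbb N_0^d}\frac{(\sigma)_{|\mathbf n|}}{\mathbf n!}\mathbf p^{\mathbf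 n}\overline{\mathbf p}^{\mathbf n}\hat M_{\mathbf m}(\mathbf n)\overline{\hat M_{\mathbf m'}(\mathbf n)}=\delta_{\mathbf m,\mathbf m'}\frac{\mathbf m!\,\tilde{\mathbf p}^{-\mathbf m}\overline{\tilde{\mathbf p}}^{-\mathbf m}}{(\sigma)_{|\mathbf m|}|p_0|^{2\sigma}},$$ $$\sum_{\mathbf m\in\mathbb N_0^d}\frac{(\sigma)_{|\mathbf m|}}{\mathbf m!}\tilde{\mathbf p}^{\mathbf m}\overline{\tilde{\mathbf p}}^{\mathbf m}\hat M_{\mathbf m}(\mathbf n)\overline{\hat M_{\mathbf m}(\mathbf n')}=\delta_{\mathbf n,\mathbf n'}\frac{\mathbf n!\,\mathbf p^{-\mathbf n}\overline{\mathbf p}^{-\mathbf n}}{(\sigma)_{|\mathbf n|}|p_0|^{2\sigma}}.$$ (ii) Generating function: for $\mathbf t\in\mathbb C^d$ sufficiently close to $0$, $$\sum_{\mathbf m\in\mathbb N_0^d}\frac{(\sigma)_{|\mathbf m|}}{\mathbf m!}\hat M_{\mathbf m}(\mathbf n;U,\sigma)\mathbf t^{\mathbf m}=\Big(1-\sum_{j=1}^lt_j\Big)^{-\sigma-|\mathbf n|}\prod_{i=1}^k\Big(1-\sum_{j=1}^dU_{i,j}t_j\Big)^{n_i}\prod_{i=k+1}^d\Big(-\sum_{j=1}^dU_{i,j}t_j\Big)^{n_i}.$$ (iii) Duality: $\hat M_{\mathbf m}(\mathbf n;U,\sigma)=\hat M_{\mathbf n}(\mathbf m;U^t,\sigma)$,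 where the right-hand side is the degenerate Meixner polynomial with respect to the pair $(l,k)$. (iv) Difference equations: for $s=1,\dots,d$, $$\left|\tfrac{p_0}{p_s}\right|^2n_s\hat M_{\mathbf m}(\mathbf n)=\Big(\chi_k(s)(\sigma+|\mathbf m|)+\sum_{i=1}^d|U_{s,i}\tilde p_i|^2m_i\Big)\hat M_{\mathbf m}(\mathbf n)+\sum_{\substack{i,j=1\\ i\neq j}}^d\overline{U_{s,i}}U_{s,j}|\tilde p_i|^2m_j\hat M_{\mathbf m-\mathbf v_j+\mathbf v_i}(\mathbf n)$$ $$-\chi_k(s)\Big(\sum_{i=1}^dU_{s,i}m_i\hat M_{\mathbf m-\mathbf v_i}(\mathbf n)+(\sigma+|\mathbf m|)\sum_{i=1}^d\overline{U_{s,i}}|\tilde p_i|^2\hat M_{\mathbf m+\mathbf v_i}(\mathbf n)\Big),$$ where $\chi_k(s)=1$ if $s\le k$ and $\chi_k(s)=0$ if $s\ge k+1$.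
   Context: Notation: $\mathbb N_0=\{0,1,2,\dots\}$. For $\mathbf x\in\mathbb C^d$: $|\mathbf x|=x_1+\cdots+x_d$ (plain sum), $\overline{\mathbf x}$ is the entrywise conjugate. For $\mathbf n\in\mathbb N_0^d$: $\mathbf n!=n_1!\cdots n_d!$, $\mathbf x^{\pm\mathbf n}=x_1^{\pm n_1}\cdots x_d^{\pm n_d}$. $(\beta)_n=\beta(\beta+1)\cdots(\beta+n-1)$. $\dagger$ denotes conjugate transpose. $\mathbf 1_k\in\mathbb C^d$ is the vector whose first $k$ entries are $1$ and whose remaining entries are $0$. $\mathbf v_i$ is the $i$-th standard basis vector of length $d$. Terms in which a polynomial's index has a negative entry carry a factor $0$ and are read as $0$; $0^0=1$. Degenerate multivariate Meixner polynomials (with respect to $k,l\in\{1,\dots,d\}$): for $\sigma>0$, a complex $d\times d$ matrix $U$ and $\mathbf m,\mathbf n\in\mathbb N_0^d$, $$\hat M_{\mathbf m}(\mathbf n;U,\sigma)=\sum_{(a_{i,j})\in\mathbb M_{k,l}(\mathbf m,\mathbf n)}\frac{\prod_{j=1}^d(-m_j)_{\sum_{i=1}^da_{i,j}}\prod_{i=1}^d(-n_i)_{\sum_{j=1}^da_{i,j}}}{(\sigma)_{\sum_{i,j=1}^da_{i,j}}}\prod_{i,j=1}^d\frac1{a_{i,j}!}\prod_{\substack{1\le i\le k\\1\le j\le l}}(1-U_{i,j})^{a_{i,j}}\prod_{\substack{1\le i,j\le d\\ i\ge k+1\text{ or }j\ge l+1}}(-U_{i,j})^{a_{i,j}},$$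 where $\mathbb M_{k,l}(\mathbf m,\mathbf n)$ is the set of $d\times d$ matrices $(a_{i,j})$ with entries in $\mathbb N_0$ such that $\sum_{j=1}^da_{i,j}=n_i$ for $i=k+1,\dots,d$ and $\sum_{i=1}^da_{i,j}=m_j$ for $j=l+1,\dots,d$. *)

(* Defs.v *)
From HB Require Import structures.
From mathcomp Require Import all_boot all_order all_algebra finmap.
From mathcomp Require Import sesquilinear spectral complex.
From mathcomp Require Import all_classical all_reals all_analysis.
From mathcomp Require Import summability.
Set Implicit Arguments.
Unset Strict Implicit.
Unset Printing Implicit Defensive.
Import Order.TTheory GRing.Theory Num.Theory.
Import numFieldNormedType.Exports.
Local Open Scope classical_set_scope.
Local Open Scope ring_scope.
Local Open Scope sesquilinear_scope.
Local Open Scope complex_scope.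

(* Indices are 0-based: the index i : 'I_d stands for i.+1 in 1, ..., d, so
   "i <= k" in the 1-based convention reads (i < k)%N. *)

Notation mindex d := {ffun 'I_d -> nat}.

Section Multiindex.
Variables (K : fieldType) (d : nat).
Implicit Types (m : mindex d) (x : 'I_d -> K).

Definition msize m : nat := (\sum_i m i)%N.

Definition mfact m : nat := (\prod_i (m i)`!)%N.

Definition mpow x m : K := \prod_i x i ^+ m i.

Definition mpowV x m : K := \prod_i x i ^- m i.

Definition mincr m (i : 'I_d) : mindex d := [ffun s => (m s + (s == i))%N].

(* Truncated at 0: in the difference equations this only occurs multiplied by
   m j, which vanishes when the truncation is effective. *)
Definition mdecr m (j : 'I_d) : mindex d := [ffun s => (m s - (s == j))%N].

(* The rising factorial (x)_n. *)
Definition poch (x : K) (n : nat) : K := \prod_(i < n) (x + i%:R).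

End Multiindex.

Section DegenerateMeixner.
Variables (K : fieldType) (d k l : nat).

Definition Mkl (m n : mindex d) : set 'M[nat]_d :=
  [set A | (forall i : 'I_d, (k <= i)%N -> (\sum_j A i j)%N = n i) /\
           (forall j : 'I_d, (l <= j)%N -> (\sum_i A i j)%N = m j)].

(* Mkl m n may be infinite, but only finitely many terms are nonzero: the
   factor (- m j)_(\sum_i A i j) vanishes as soon as \sum_i A i j > m j. *)
Definition hmeixner (sigma : K) (U : 'M[K]_d) (m n : mindex d) : K :=
  \sum_(A \in Mkl m n)
    ((\prod_(j < d) poch (- (m j)%:R) (\sum_(i < d) A i j)%N) *
     (\prod_(i < d) poch (- (n i)%:R) (\sum_(j < d) A i j)%N) /
     poch sigma (\sum_(i < d) \sum_(j < d) A i j)%N *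
     (\prod_(i < d) \prod_(j < d) ((A i j)`!%:R)^-1) *
     (\prod_(i < d | (i < k)%N) \prod_(j < d | (j < l)%N)
        (1 - U i j) ^+ A i j) *
     (\prod_(i < d) \prod_(j < d | (k <= i)%N || (l <= j)%N)
        (- U i j) ^+ A i j)).

End DegenerateMeixner.

Section Matrices.
Variables (K : numClosedFieldType) (d : nat).

Definition ones_upto (k : nat) : 'cV[K]_d := \col_i (i < k)%N%:R.

Definition Uhat (k l : nat) (U : 'M[K]_d) : 'M[K]_(1 + d) :=
  block_mx 1%:M (ones_upto l)^T (ones_upto k) U.

(* diag(1, -|p_1|^2, ..., -|p_k|^2, -|p_0|^2, ..., -|p_0|^2) *)
Definition Cmx (k : nat) (p0 : K) (p : 'I_d -> K) : 'M[K]_(1 + d) :=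
  diag_mx (row_mx 1%:M
    (\row_i (if (i < k)%N then - `|p i| ^+ 2 else - `|p0| ^+ 2))).

End Matrices.

(* The family f is unconditionally (equivalently, absolutely) summable with sum
   s: its finite partial sums converge to s along the directed set of finite
   subsets of I. The topology of R[i] is reached through the alias R[i]^o. *)
Definition has_sum (R : realType) (I : choiceType) (f : I -> R[i]) (s : R[i]) :
    Prop :=
  partial_sum f @ totally --> (s : R[i]^o).

(* Main.v *)
Require Import Defs.
From HB Require Import structures.
From mathcomp Require Import all_boot all_order all_algebra finmap.
From mathcomp Require Import sesquilinear spectral complex.
From mathcomp Require Import all_classical all_reals all_analysis.
From mathcomp Require Import summability.
From mathcomp Require Import zify ring lra.
Set Implicit Arguments.
Unset Strict Implicit.
Unset Printing Implicit Defensive.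
Import Order.TTheory GRing.Theory Num.Theory.
Import numFieldNormedType.Exports.
Local Open Scope classical_set_scope.
Local Open Scope ring_scope.
Local Open Scope sesquilinear_scope.
Local Open Scope complex_scope.

(** Everything follows from the generating function

      G_n(t) = sum_m (sigma)_|m| / m! M_m(n) t^m
             = L_0^(- sigma - |n|) prod_i L_i^(n_i),

    where L_0 = 1 - sum_(j < l) t_j and L_i = chi_k(i) - sum_j U_ij t_j. To see
    it, write L_i / L_0 = chi_k(i) + sum_j (chi_k(i) chi_l(j) - U_ij) t_j / L_0,
    expand the n_i-th power of each of these by the multinomial theorem, one
    row of a matrix of exponents for each i, and expand the resulting power of
    L_0 by the negative binomial series. Power series are handled as families
    of coefficients indexed by multi-indices, and the expansion is proved by
    adding 1 to one entry of n at a time (gencoef_mincr, gencoef_hmeixner).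

    The matrix condition says that the linear substitution Uhat is, up to the
    factor |p_0|^2, an isometry between two Hermitian forms of signature (1, d).
    Let w_si be the product of |pt_i|^2 with the conjugate of U_si. The condition
    implies that the first-order operator
      D_s = chi_k(s) (sigma + Euler operator) - sum_i w_si d/dt_i
    acts on the factors L_r as a derivation would that kills L_0 and every L_r
    except L_s. So D_s divides G_n by L_s, up to the factor n_s |p_0 / p_s|^2
    (diffD_gencoef); the quotient is G_(n - v_s) for the parameter sigma + 1.
    Multiplying back by L_s gives
      L_s D_s G_n = n_s |p_0 / p_s|^2 G_n,
    and its coefficient at t^m is the difference equation.

    For the orthogonality, equip power series with the Hermitian form in which
    the monomials t^m are orthogonal with squared norms m! / (sigma)_|m| |pt|^(2m).
    Then multiplication by L_s, from parameter sigma + 1 to parameter sigma, is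
    adjoint to D_s / sigma (adjoint_pair). Hence the pairing of G_(n + v_s)
    with G_n' at parameter sigma is a multiple of the pairing of G_n with
    G_(n' - v_s) at parameter sigma + 1, and induction on n reduces everything to
    the pairing of G_0 with itself, a negative binomial series. This is the
    second orthogonality relation. Since the matrix condition can be read from
    the other side, the first one is the second for the transposed data, by the
    duality M_m(n; U) = M_n(m; U^t), which transposes the summation matrix.

    Convergence: all the families that occur are dominated by those of negative
    binomial series, whose partial sums over boxes are bounded by
    induction on the exponent, using L_0 L_0^(- tau - 1) = L_0^(- tau); the same
    identity then determines the sum. *)

(** * Multi-indices, rising factorials and formal power series *)

Section MultiindexTheory.
Variable d : nat.
Implicit Types (m n : mindex d) (i j : 'I_d).

Definition midx0 : mindex d := [ffun => 0%N].

Lemma mincrE m i s : mincr m i s = (m s + (s == i))%N.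
Proof. by rewrite ffunE. Qed.

Lemma mdecrE m i s : mdecr m i s = (m s - (s == i))%N.
Proof. by rewrite ffunE. Qed.

Lemma mincrK i : cancel (fun m => mincr m i) (fun m => mdecr m i).
Proof. by move=> m; apply/ffunP => s; rewrite !ffunE addnK. Qed.

Lemma mdecrK m i : (0 < m i)%N -> mincr (mdecr m i) i = m.
Proof.
move=> mi; apply/ffunP => s; rewrite !ffunE.
by have [->|_] := eqVneq s i; rewrite ?subn0 ?addn0 // subnK.
Qed.

Lemma mincr_mdecr m i j : i != j -> mdecr (mincr m i) j = mincr (mdecr m j) i.
Proof.
move=> ij; apply/ffunP => s; rewrite !ffunE.
have [->|_] := eqVneq s j; last by rewrite !subn0.
by rewrite eq_sym (negbTE ij) !addn0.
Qed.

Lemma msize_mincr m i : msize (mincr m i) = (msize m).+1.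
Proof.
rewrite /msize (eq_bigr _ (fun s _ => mincrE m i s)) big_split /= -/(msize m).
by rewrite (bigD1 i) //= eqxx big1 ?addn0 ?addn1 // => j /negbTE->.
Qed.

Lemma mfact_mincr m i : mfact (mincr m i) = ((m i).+1 * mfact m)%N.
Proof.
rewrite /mfact (bigD1 i) //= [in RHS](bigD1 i) //= mincrE eqxx addn1 factS -mulnA.
by do 2!congr muln; apply: eq_bigr => j /negbTE ji; rewrite mincrE ji addn0.
Qed.

Lemma mfact_gt0 m : (0 < mfact m)%N.
Proof. by apply: prodn_gt0 => i; rewrite fact_gt0. Qed.

Lemma mpow_mincr (K : fieldType) (x : 'I_d -> K) m i :
  mpow x (mincr m i) = x i * mpow x m.
Proof.
rewrite /mpow (bigD1 i) //= [in RHS](bigD1 i) //= mincrE eqxx addn1 exprS -mulrA.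
by do 2!congr (_ * _); apply: eq_bigr => j /negbTE ji; rewrite mincrE ji addn0.
Qed.

Lemma msize0 : msize midx0 = 0%N.
Proof. by rewrite /msize big1 // => i _; rewrite ffunE. Qed.

Lemma mfact0 : mfact midx0 = 1%N.
Proof. by rewrite /mfact big1 // => i _; rewrite ffunE. Qed.

Lemma mpow0 (K : fieldType) (x : 'I_d -> K) : mpow x midx0 = 1.
Proof. by rewrite /mpow big1 // => i _; rewrite ffunE. Qed.

Lemma msize_eq0 m : msize m = 0%N -> m = midx0.
Proof.
move=> /eqP; rewrite sum_nat_eq0 => /forallP m0.
by apply/ffunP => i; rewrite ffunE; apply/eqP/m0.
Qed.

Lemma mindex_gt0 m : (0 < msize m)%N -> exists i, (0 < m i)%N.
Proof.
move=> m0; case: (boolP [exists i, (0 < m i)%N]) => [/existsP //|].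
rewrite negb_exists => /forallP m_eq0; move: m0.
by rewrite /msize big1 // => i _; apply/eqP; have := m_eq0 i; rewrite -eqn0Ngt.
Qed.

Lemma mindex_ind (P : mindex d -> Prop) :
  P midx0 -> (forall m i, P m -> P (mincr m i)) -> forall m, P m.
Proof.
move=> P0 PS m; have [N] := ubnP (msize m); elim: N m => // N IH m.
rewrite ltnS => mN; have [m0|] := posnP (msize m); first by rewrite (msize_eq0 m0).
move=> /mindex_gt0[i mi]; rewrite -(mdecrK mi); apply/PS/IH.
by rewrite -(msize_mincr _ i) mdecrK.
Qed.

End MultiindexTheory.
Arguments midx0 {d}.

Section Pochhammer.
Variable K : numFieldType.
Implicit Types x : K.

Lemma poch0 x : poch x 0 = 1.
Proof. by rewrite /poch big_ord0. Qed.

Lemma pochSr x n : poch x n.+1 = poch x n * (x + n%:R).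
Proof. by rewrite /poch big_ord_recr. Qed.

Lemma pochS x n : poch x n.+1 = x * poch (x + 1) n.
Proof.
rewrite /poch big_ord_recl addr0; congr (_ * _).
by apply: eq_bigr => i _; rewrite /= /bump /= add1n -natr1; ring.
Qed.

Lemma pochD x m n : poch x (m + n) = poch x m * poch (x + m%:R) n.
Proof.
elim: n => [|n IH]; first by rewrite addn0 poch0 mulr1.
by rewrite addnS !pochSr IH natrD; ring.
Qed.

Lemma poch_gt0 t n : 0 < poch (t.+1%:R : K) n.
Proof. by apply: prodr_gt0 => i _; rewrite -natrD ltr0n. Qed.

Lemma poch_ge0 t n : 0 <= poch (t%:R : K) n.
Proof. by apply: prodr_ge0 => i _; rewrite -natrD ler0n. Qed.

Lemma poch_opp_nat N r : poch (- N%:R : K) r = (-1) ^+ r * (N ^_ r)%:R.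
Proof.
elim: r => [|r IH]; first by rewrite poch0 ffactn0 mul1r.
rewrite pochSr IH ffactnSr exprSr natrM.
have [rN|Nr] := leqP r N; first by rewrite natrB //; ring.
by rewrite ffact_small //; ring.
Qed.

End Pochhammer.

Section FormalSeries.
Variables (K : numFieldType) (d : nat).
Implicit Types (f g : mindex d -> K) (i j : 'I_d) (m : mindex d) (u w : 'I_d -> K).

(** A family [f] stands for the power series with coefficients [f m]; this is
    multiplication by the variable [x_j]. *)
Definition mulX j f : mindex d -> K :=
  fun m => (0 < m j)%N%:R * f (mdecr m j).

(** The partial derivative in [x_i]. *)
Definition dX i f : mindex d -> K :=
  fun m => (m i).+1%:R * f (mincr m i).

(** Multiplication by the affine form [c - sum_j u_j x_j]. *)
Definition mulL (c : K) u f : mindex d -> K :=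
  fun m => c * f m - \sum_j u j * mulX j f m.

(** The operator [c (t + E) - sum_i w_i d/dx_i], with [E] the Euler operator.
    On the homogenization of degree [- t] of the series it is the constant
    vector field with components [- c] and [- w_i], because [- (t + E)] is then
    the derivative in the homogenizing variable. *)
Definition diffD (t : nat) (c : K) w f : mindex d -> K :=
  fun m => c * (t + msize m)%:R * f m - \sum_i w i * dX i f m.

(** The series [sum_N F N (u . x)^N / N!]. *)
Definition egf (F : nat -> K) u : mindex d -> K :=
  fun m => F (msize m) / (mfact m)%:R * mpow u m.

(** The negative binomial series [(1 - u . x)^(- t)]. *)
Definition negbin u (t : nat) : mindex d -> K := egf (poch t%:R) u.

Lemma mulX_mincr j f m : mulX j f (mincr m j) = f m.
Proof. by rewrite /mulX mincrE eqxx addn1 mincrK mul1r. Qed.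

Lemma mulX0 j f m : m j = 0%N -> mulX j f m = 0.
Proof. by move=> mj; rewrite /mulX mj mul0r. Qed.

Lemma mulX_mincr_neq i j f m : i != j ->
  mulX j f (mincr m i) = mulX j (fun m => f (mincr m i)) m.
Proof.
by move=> ij; rewrite /mulX mincrE eq_sym (negbTE ij) addn0 mincr_mdecr.
Qed.

Lemma dX_mulX i j f m :
  dX i (mulX j f) m = mulX j (dX i f) m + (i == j)%:R * f m.
Proof.
have [<-|ij] := eqVneq i j.
  rewrite /dX mulX_mincr mul1r; have [mi0|mi0] := posnP (m i).
    by rewrite mulX0 // mi0 add0r mul1r.
  rewrite -[m in mulX _ _ m](mdecrK mi0) mulX_mincr mdecrK // mdecrE eqxx.
  by rewrite subn1 prednK // -natr1 mulrDl mul1r.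
rewrite mul0r addr0 /dX mulX_mincr_neq // /mulX mdecrE (negbTE ij) subn0.
by rewrite mulrCA.
Qed.

Lemma mulX_lin j (I : finType) (a : I -> K) (F : I -> mindex d -> K) m :
  mulX j (fun m => \sum_i a i * F i m) m = \sum_i a i * mulX j (F i) m.
Proof. by rewrite /mulX mulr_sumr; apply: eq_bigr => i _; rewrite mulrCA. Qed.

Lemma dX_lin j (I : finType) (a : I -> K) (F : I -> mindex d -> K) m :
  dX j (fun m => \sum_i a i * F i m) m = \sum_i a i * dX j (F i) m.
Proof. by rewrite /dX mulr_sumr; apply: eq_bigr => i _; rewrite mulrCA. Qed.

Lemma mulXC i j f m : mulX i (mulX j f) m = mulX j (mulX i f) m.
Proof.
have [->//|ij] := eqVneq i j.
have dd : mdecr (mdecr m i) j = mdecr (mdecr m j) i.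
  by apply/ffunP => s; rewrite !ffunE subnAC.
rewrite /mulX !mdecrE dd (negbTE ij) eq_sym (negbTE ij) !subn0.
by rewrite mulrCA.
Qed.

Lemma mulX_mulL j c u f m : mulX j (mulL c u f) m = mulL c u (mulX j f) m.
Proof.
rewrite /mulL; under eq_bigr do rewrite mulXC.
by rewrite -(mulX_lin j u (fun i => mulX i f)) /mulX; ring.
Qed.

Lemma mulLZ (a c : K) u f m : mulL c u (fun m => a * f m) m = a * mulL c u f m.
Proof.
rewrite /mulL mulrBr mulr_sumr; congr (_ - _); first by ring.
by apply: eq_bigr => j _; rewrite /mulX; ring.
Qed.

(** The Leibniz rule for a constant vector field and a linear form; the last
    factor is minus the derivative of the form. The parameter changes because
    multiplication by a linear form changes the degree of homogeneity. *)
Lemma diffD_mulL t c w c' u f m :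
  diffD t c w (mulL c' u f) m =
  mulL c' u (diffD t.+1 c w f) m - (c * c' - \sum_j u j * w j) * f m.
Proof.
have sumuw : \sum_i w i * (\sum_j u j * ((i == j)%:R * f m)) =
  (\sum_j u j * w j) * f m.
  rewrite mulr_suml; apply: eq_bigr => i _.
  rewrite (bigD1 i) //= eqxx big1 ?addr0; first by rewrite mul1r mulrCA mulrA.
  by move=> j /negbTE ji; rewrite eq_sym ji mul0r mulr0.
have dXL i : dX i (mulL c' u f) m = c' * dX i f m - \sum_j u j * mulX j (dX i f) m
    - \sum_j u j * ((i == j)%:R * f m).
  transitivity (c' * dX i f m - \sum_j u j * dX i (mulX j f) m).
    by rewrite -(dX_lin i u (fun j => mulX j f)) /dX /mulL; ring.
  rewrite -addrA -opprD -big_split /=; congr (_ - _).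
  by apply: eq_bigr => j _; rewrite dX_mulX mulrDr.
have mulXD j : mulX j (diffD t.+1 c w f) m =
    c * (t + msize m)%:R * mulX j f m - \sum_i w i * mulX j (dX i f) m.
  rewrite -(mulX_lin j w (fun i => dX i f)) /diffD /mulX.
  have [mj|mj] /= := posnP (m j); first by rewrite ?mulr0n; ring.
  have -> : msize m = (msize (mdecr m j)).+1 by rewrite -(msize_mincr _ j) mdecrK.
  by rewrite addSnnS; ring.
rewrite [in LHS]/diffD [in RHS]/mulL.
under eq_bigr do rewrite dXL.
under [in RHS]eq_bigr do rewrite mulXD.
have -> : \sum_i w i * (c' * dX i f m - \sum_j u j * mulX j (dX i f) m
    - \sum_j u j * ((i == j)%:R * f m)) =
  c' * (\sum_i w i * dX i f m) - (\sum_i \sum_j w i * u j * mulX j (dX i f) m)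
  - (\sum_j u j * w j) * f m.
  rewrite -sumuw mulr_sumr -!sumrB; apply: eq_bigr => i _; rewrite !mulrBr.
  congr (_ - _ - _); first by rewrite mulrCA.
  by rewrite mulr_sumr; apply: eq_bigr => j _; rewrite mulrA.
have -> : \sum_j u j * (c * (t + msize m)%:R * mulX j f m -
    \sum_i w i * mulX j (dX i f) m) =
  c * (t + msize m)%:R * (\sum_j u j * mulX j f m) -
   (\sum_i \sum_j w i * u j * mulX j (dX i f) m).
  rewrite exchange_big /= mulr_sumr -sumrB; apply: eq_bigr => j _.
  rewrite mulrBr mulrCA; congr (_ - _); rewrite mulr_sumr.
  by apply: eq_bigr => i _; rewrite mulrCA mulrA.
rewrite /mulL /diffD addSn -natr1; ring.
Qed.

Lemma negbin_raise u t m : (t + msize m)%:R * negbin u t m = t%:R * negbin u t.+1 m.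
Proof.
have key : poch (t%:R : K) (msize m) * (t%:R + (msize m)%:R) =
   t%:R * poch t.+1%:R (msize m) by rewrite -pochSr pochS natr1.
rewrite /negbin /egf natrD.
transitivity (poch (t%:R : K) (msize m) * (t%:R + (msize m)%:R) /
  (mfact m)%:R * mpow u m); first by ring.
by rewrite key; ring.
Qed.

Lemma mfact_neq0 m : (mfact m)%:R != 0 :> K.
Proof. by rewrite pnatr_eq0 -lt0n mfact_gt0. Qed.

Lemma dX_negbin u t j m : dX j (negbin u t) m = t%:R * u j * negbin u t.+1 m.
Proof.
rewrite /dX /negbin /egf msize_mincr mfact_mincr mpow_mincr pochS natr1 natrM.
have := mfact_neq0 m; have : (m j).+1%:R != 0 :> K by rewrite pnatr_eq0.
by move=> *; field; rewrite nat1r; apply/andP.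
Qed.

Lemma diffD_negbin u t c w m :
  diffD t c w (negbin u t) m = t%:R * (c - \sum_j u j * w j) * negbin u t.+1 m.
Proof.
rewrite /diffD -mulrA negbin_raise.
have -> : \sum_i w i * dX i (negbin u t) m =
  t%:R * (\sum_j u j * w j) * negbin u t.+1 m.
  by rewrite mulr_sumr mulr_suml; apply: eq_bigr => i _; rewrite dX_negbin; ring.
ring.
Qed.

Lemma negbin0 u t : negbin u t midx0 = 1.
Proof. by rewrite /negbin /egf msize0 mfact0 mpow0 poch0 divr1 mulr1. Qed.

Lemma mulX_egf F u j m : u j * mulX j (egf F u) m =
  (m j)%:R * (F (msize m).-1 / (mfact m)%:R * mpow u m).
Proof.
have [mj|mj] := posnP (m j); first by rewrite mulX0 // mj mulr0 mul0r.
have [q ->] : exists q, m = mincr q j by exists (mdecr m j); rewrite mdecrK.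
rewrite mulX_mincr mincrE eqxx addn1.
rewrite /egf msize_mincr mfact_mincr mpow_mincr /= natrM.
have := mfact_neq0 q; have : (q j).+1%:R != 0 :> K by rewrite pnatr_eq0.
by move=> *; field; rewrite nat1r; apply/andP.
Qed.

Lemma sum_mulX_egf F u m : \sum_j u j * mulX j (egf F u) m =
  (msize m)%:R * (F (msize m).-1 / (mfact m)%:R * mpow u m).
Proof.
by rewrite (eq_bigr _ (fun j _ => mulX_egf F u j m)) -mulr_suml -natr_sum.
Qed.

(** [(1 - u . x) (1 - u . x)^(- t - 1) = (1 - u . x)^(- t)]; on coefficients it
    is [(t + 1)_M - M (t + 1)_(M - 1) = (t)_M]. *)
Lemma mulL_negbin u t m : mulL 1 u (negbin u t.+1) m = negbin u t m.
Proof.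
rewrite /mulL sum_mulX_egf mul1r /negbin /egf; case: (msize m) => [|M] /=.
  by rewrite mul0r subr0 !poch0.
by rewrite [poch t%:R _]pochS natr1 pochSr -[M.+1%:R]natr1 -[t.+1%:R]natr1; ring.
Qed.

End FormalSeries.

(** * Expansion of products of linear forms over nonnegative integer matrices *)

Section FiniteSums.
Variables (K : numFieldType) (I : choiceType).
Implicit Types f g : I -> K.

(** Additivity of [\sum_(i \in A)] needs this, since that sum is [0] by
    convention when infinitely many terms are nonzero. *)
Definition fsupported f := exists A : {fset I}, forall i, i \notin A -> f i = 0.

Lemma fsupported_le f g : (forall i, g i = 0 -> f i = 0) ->
  fsupported g -> fsupported f.
Proof. by move=> fg [A gA]; exists A => i /gA/fg. Qed.

Lemma fsumD f g : fsupported f -> fsupported g ->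
  \sum_(i \in [set: I]) (f i + g i) =
  \sum_(i \in [set: I]) f i + \sum_(i \in [set: I]) g i.
Proof.
move=> [A fA] [B gB].
rewrite !(@fsbigTE _ _ _ _ (A `|` B)%fset) ?big_split //.
- by move=> i; rewrite in_fsetU negb_or => /andP[_ /gB].
- by move=> i; rewrite in_fsetU negb_or => /andP[/fA].
- by move=> i; rewrite in_fsetU negb_or => /andP[/fA-> /gB->]; rewrite addr0.
Qed.

Lemma fsupportedD f g : fsupported f -> fsupported g ->
  fsupported (fun i => f i + g i).
Proof.
move=> [A fA] [B gB]; exists (A `|` B)%fset => i.
by rewrite in_fsetU negb_or => /andP[/fA-> /gB->]; rewrite addr0.
Qed.

Lemma fsupported_sum (J : finType) (P : pred J) (F : J -> I -> K) :
  (forall j, fsupported (F j)) ->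
  fsupported (fun i => \sum_(j | P j) F j i) /\
  \sum_(i \in [set: I]) \sum_(j | P j) F j i =
  \sum_(j | P j) \sum_(i \in [set: I]) F j i.
Proof.
move=> Ffin; elim: index_enum => [|j s [IHs IHe]].
  split; first by exists fset0 => i _; rewrite big_nil.
  by rewrite big_nil fsbig1 // => i _; rewrite big_nil.
have fsE : (fun i => \sum_(j <- j :: s | P j) F j i) =
    (fun i => (if P j then F j i else 0) + \sum_(j <- s | P j) F j i).
  by apply/funext => i; rewrite big_cons; case: ifP => //; rewrite add0r.
have Fj : fsupported (fun i => if P j then F j i else 0).
  by apply: fsupported_le (Ffin j) => i ->; rewrite if_same.
split; first by rewrite fsE; apply: fsupportedD.
rewrite (eq_fsbigr (fun i => (if P j then F j i else 0) +
  \sum_(j <- s | P j) F j i)).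
  rewrite fsumD // big_cons IHe; case: ifP => // _.
  by rewrite fsbig1 ?add0r.
by move=> i _; rewrite big_cons; case: ifP => //; rewrite add0r.
Qed.

Lemma fsum_reindex f (h : I -> I) : injective h ->
  (forall i, ~ (range h) i -> f i = 0) ->
  \sum_(i \in [set: I]) f i = \sum_(i \in [set: I]) f (h i).
Proof.
move=> h_inj f0; rewrite -(@fsbig_widen _ _ _ _ (range h)) //.
  by rewrite (reindex_fsbig h setT) //; split => // x y _ _; apply: h_inj.
by move=> i [_ /f0].
Qed.

End FiniteSums.

Section MultinomialCoefficients.
Variables (K : numFieldType) (d : nat).
Implicit Types (f g : mindex d -> K) (i j : 'I_d) (m a c : mindex d)
  (u w : 'I_d -> K).

(** The coefficients of [(b + w . x)^N], given by the multinomial theorem: a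
    monomial of degree [r < N] occurs only when the constant term [b] does. *)
Definition row_coef (b : bool) w (N : nat) : mindex d -> K :=
  egf (fun r => (N ^_ r)%:R * (b || (r == N))%:R) w.

(** One more factor [b + w . x]; on coefficients this is the Pascal rule for
    falling factorials. *)
Lemma row_coefS b w N a :
  row_coef b w N.+1 a = b%:R * row_coef b w N a +
    \sum_j w j * mulX j (row_coef b w N) a.
Proof.
rewrite /row_coef sum_mulX_egf /egf; case: (msize a) => [|r] /=.
  by rewrite !ffactn0 mul0r addr0; case: b; rewrite /= ?mulr0n ?mulr1n; ring.
rewrite eqSS; case: b; rewrite /= ?mulr0n ?mulr1n; last first.
  have [->|_] := eqVneq r N; last by rewrite mulr0n; ring.
  by rewrite mulr1n !ffactnn factS natrM; ring.
rewrite ffactSS ffactnSr !natrM -[N.+1%:R]natr1 -[r.+1%:R]natr1.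
have [rN|Nr] := leqP r N; first by rewrite natrB //; ring.
by rewrite ffact_small // mulr0n; ring.
Qed.

Lemma row_coef_eq0 b w N a i : (N < a i)%N -> row_coef b w N a = 0.
Proof.
move=> Na; rewrite /row_coef /egf ffact_small ?mul0r //.
by apply: leq_trans Na _; rewrite /msize (bigD1 i) //= leq_addr.
Qed.

Lemma row_coef0 b w a : row_coef b w 0 a = (a == midx0)%:R.
Proof.
have [->|a0] := eqVneq a midx0.
  by rewrite /row_coef /egf msize0 mfact0 mpow0 /= ffactn0 orbT divr1 !mulr1.
rewrite /row_coef /egf ffact_small ?mul0r // lt0n.
by apply: contraNN a0 => /eqP/msize_eq0->.
Qed.

Definition mulXn c f : mindex d -> K := fun m =>
  (\prod_j (c j <= m j)%N%:R) * f [ffun j => (m j - c j)%N].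

Lemma mulXn0 f : mulXn midx0 f = f.
Proof.
apply/funext => m; rewrite /mulXn big1 ?mul1r; last by move=> j _; rewrite ffunE.
by congr f; apply/ffunP => j; rewrite !ffunE subn0.
Qed.

Lemma mulXn_mincr c j f : mulXn (mincr c j) f = mulX j (mulXn c f).
Proof.
apply/funext => m; rewrite /mulX /mulXn mulrA; congr (_ * f _); last first.
  by apply/ffunP => s; rewrite !ffunE -subnDA addnC.
rewrite (bigD1 j) //= [in RHS](bigD1 j) //= !mulrA; congr (_ * _).
  rewrite !ffunE eqxx addn1 subn1; case: (m j) => [|N] /=; first by rewrite mul0r.
  by rewrite mul1r.
by apply: eq_bigr => s /negbTE sj; rewrite !ffunE sj addn0 subn0.
Qed.

Lemma mulXn_mulL c b u f : mulXn c (mulL b u f) = mulL b u (mulXn c f).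
Proof.
elim/mindex_ind: c => [|c j IH]; first by rewrite !mulXn0.
by rewrite !mulXn_mincr IH; apply/funext => m; rewrite mulX_mulL.
Qed.

End MultinomialCoefficients.

Section MatrixIndices.
Variable d : nat.
Implicit Types (A : 'M[nat]_d) (i j : 'I_d).

Definition mxrow_idx A i : mindex d := [ffun j => A i j].
Definition mxcols A : mindex d := [ffun j => (\sum_i A i j)%N].
Definition mxincr i j A : 'M[nat]_d :=
  \matrix_(x, y) (A x y + ((x == i) && (y == j)))%N.

Lemma mxincr_inj i j : injective (mxincr i j).
Proof.
move=> A B /matrixP AB; apply/matrixP => x y.
by have := AB x y; rewrite !mxE => /addIn.
Qed.

Lemma mxincr_range i j A : (0 < A i j)%N -> range (mxincr i j) A.
Proof.
move=> Aij; exists (\matrix_(x, y) (A x y - ((x == i) && (y == j)))%N) => //.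
apply/matrixP => x y; rewrite !mxE subnK //.
by have [/andP[/eqP-> /eqP->]|] := boolP ((x == i) && (y == j)).
Qed.

Lemma mxcols_incr i j A : mxcols (mxincr i j A) = mincr (mxcols A) j.
Proof.
apply/ffunP => y; rewrite !ffunE.
rewrite (eq_bigr (fun x => (A x y + ((x == i) && (y == j))))%N);
  last by move=> x _; rewrite mxE.
rewrite big_split /=; congr addn.
by rewrite (bigD1 i) //= eqxx big1 ?addn0 // => x /negbTE->.
Qed.

Lemma mxrow_incr i j A x : mxrow_idx (mxincr i j A) x =
  if x == i then mincr (mxrow_idx A x) j else mxrow_idx A x.
Proof.
by apply/ffunP => y; case: ifP => xi; rewrite !ffunE mxE xi /= ?addn0.
Qed.

Lemma msize_mxcols A : msize (mxcols A) = (\sum_i \sum_j A i j)%N.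
Proof. by rewrite exchange_big; apply: eq_bigr => j _; rewrite ffunE. Qed.

Lemma msize_mxrow A i : msize (mxrow_idx A i) = (\sum_j A i j)%N.
Proof. by apply: eq_bigr => j _; rewrite ffunE. Qed.

Lemma bounded_matrices N : exists B : {fset 'M[nat]_d},
  forall A, A \notin B -> exists i, exists j, (N < A i j)%N.
Proof.
exists [fset (map_mx (@nat_of_ord N.+1) A) | A in 'M['I_N.+1]_d]%fset => A.
apply: contraNP => /forallNP AN.
have {}AN i j : (A i j < N.+1)%N.
  by rewrite ltnS leqNgt; apply/negP => ?; apply: (AN i); exists j.
apply/imfsetP; exists (\matrix_(i, j) Ordinal (AN i j)) => //.
by apply/matrixP => i j; rewrite !mxE.
Qed.

End MatrixIndices.

Section GeneratingFamily.
Variables (K : numFieldType) (d k l : nat) (U : 'M[K]_d).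
Implicit Types (m n : mindex d) (t : nat) (A : 'M[nat]_d) (i j : 'I_d).

Definition cutoff (k : nat) (j : 'I_d) : K := (j < k)%N%:R.

(** The coefficient of [x_j / L_0] in [L_i / L_0], where [L_0] and [L_i] are
    the affine forms of the generating function. *)
Definition weight i j : K := (i < k)%N%:R * (j < l)%N%:R - U i j.

Definition mx_coef n A : K :=
  \prod_(i < d) row_coef (i < k)%N (weight i) (n i) (mxrow_idx A i).

(** The series of [x^c L_0^(- t - |c|)], with [c] the column sums of [A]: this
    is the product of the [(x_j / L_0)^(A i j)] with [L_0^(- t)]. *)
Definition col_series A t : mindex d -> K :=
  mulXn (mxcols A) (negbin (cutoff l) (t + msize (mxcols A))).

(** The coefficients of [L_0^(- t) prod_i (L_i / L_0)^(n_i)], after expanding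
    each of these powers; the matrix [A] collects the exponents. *)
Definition gencoef n t : mindex d -> K := fun m =>
  \sum_(A \in [set: 'M[nat]_d]) mx_coef n A * col_series A t m.

Lemma mx_coef_fsupp n (F : 'M[nat]_d -> K) :
  fsupported (fun A => mx_coef n A * F A).
Proof.
have [B BP] := bounded_matrices d (msize n); exists B => A /BP[i [j nA]].
rewrite /mx_coef (bigD1 i) //= (@row_coef_eq0 _ _ _ _ _ _ j) ?mul0r // ffunE.
by apply: leq_ltn_trans nA; rewrite /msize (bigD1 i) //= leq_addr.
Qed.

Lemma col_series_incr i j A t : col_series (mxincr i j A) t =
  mulX j (col_series A t.+1).
Proof. by rewrite /col_series mxcols_incr mulXn_mincr msize_mincr addSnnS. Qed.

Lemma mulL_col_series A t m :
  mulL 1 (cutoff l) (col_series A t.+1) m = col_series A t m.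
Proof.
rewrite /col_series -mulXn_mulL; congr (mulXn _ _ m); apply/funext => q.
by rewrite addSn mulL_negbin.
Qed.

Lemma mulX_gencoef j n t m :
  mulX j (gencoef n t) m =
  \sum_(A \in [set: 'M[nat]_d]) mx_coef n A * mulX j (col_series A t) m.
Proof.
by rewrite /mulX mulr_fsumr; apply: eq_fsbigr => A _; rewrite mulrCA.
Qed.

Lemma mulL_gencoef n t m : mulL 1 (cutoff l) (gencoef n t.+1) m = gencoef n t m.
Proof.
rewrite /mulL mul1r; under eq_bigr do rewrite mulX_gencoef mulr_fsumr.
have fs j :
    fsupported (fun A => cutoff l j * (mx_coef n A * mulX j (col_series A t.+1) m)).
  apply: fsupported_le (mx_coef_fsupp n (fun A => mulX j (col_series A t.+1) m)).
  by move=> A ->; rewrite mulr0.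
have [fsS <-] := fsupported_sum xpredT fs.
rewrite -mulN1r mulr_fsumr -fsumD; last first.
- by apply: fsupported_le fsS => A ->; rewrite mulr0.
- exact: mx_coef_fsupp.
apply: eq_fsbigr => A _; rewrite -(mulL_col_series A t) /mulL mul1r mulrBr mulN1r.
by congr (_ - _); rewrite mulr_sumr; apply: eq_bigr => j _; rewrite mulrCA.
Qed.

Lemma mx_coef_mincr n i A (x : K) : mx_coef (mincr n i) A * x =
  (i < k)%N%:R * (mx_coef n A * x) + \sum_j weight i j *
    ((\prod_(s < d | s != i) row_coef (s < k)%N (weight s) (n s) (mxrow_idx A s) *
      mulX j (row_coef (i < k)%N (weight i) (n i)) (mxrow_idx A i)) * x).
Proof.
rewrite /mx_coef (bigD1 i) //= [in RHS](bigD1 i) //= mincrE eqxx addn1 row_coefS.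
rewrite (eq_bigr (fun s : 'I_d => row_coef (s < k)%N (weight s) (n s)
  (mxrow_idx A s))); last first.
  by move=> s /negbTE si; rewrite mincrE si addn0.
rewrite mulrDl mulrDl !mulrA; congr (_ + _); rewrite mulr_suml mulr_suml.
by apply: eq_bigr => j _; ring.
Qed.

(** The recursion that determines the generating function. Expanding one more
    factor [L_i / L_0] gives [chi_i G_n(t) + sum_j weight_ij x_j G_n(t + 1)],
    where [G_n(t)] is [L_0 G_n(t + 1)] by [mulL_gencoef], and
    [chi_i L_0 + sum_j weight_ij x_j] is [L_i]. *)
Lemma gencoef_mincr n i t m :
  gencoef (mincr n i) t m = mulL (i < k)%N%:R (U i) (gencoef n t.+1) m.
Proof.
pose G j A :=
  (\prod_(s < d | s != i) row_coef (s < k)%N (weight s) (n s) (mxrow_idx A s) *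
   mulX j (row_coef (i < k)%N (weight i) (n i)) (mxrow_idx A i)) *
  col_series A t m.
(* The matrices with a positive (i, j) entry are the [mxincr i j A], on which
   the j-th term of the Pascal rule is the term of A, multiplied by x_j. *)
have G_incr j A : G j (mxincr i j A) = mx_coef n A * mulX j (col_series A t.+1) m.
  rewrite /G col_series_incr mxrow_incr eqxx mulX_mincr /mx_coef.
  rewrite [in RHS](bigD1 i) //= [_ * row_coef _ _ _ _]mulrC; congr (_ * _ * _).
  by apply: eq_bigr => s /negbTE si; rewrite mxrow_incr si.
have G0 j A : ~ range (mxincr i j) A -> G j A = 0.
  move=> NA; rewrite /G mulX0 ?mulr0 ?mul0r // ffunE; apply/eqP.
  by rewrite -leqn0 leqNgt; apply/negP => /mxincr_range.
have Gsum j : \sum_(A \in [set: 'M[nat]_d]) G j A = mulX j (gencoef n t.+1) m.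
  rewrite (fsum_reindex (@mxincr_inj d i j) (@G0 j)) mulX_gencoef.
  by apply: eq_fsbigr => A _; rewrite G_incr.
have Gfs j : fsupported (G j).
  have [B BP] := mx_coef_fsupp n (fun A => mulX j (col_series A t.+1) m).
  exists [fset mxincr i j A | A in B]%fset => A AB.
  have [[A' _ AE]|/G0 //] := pselect (range (mxincr i j) A).
  rewrite -AE G_incr BP //; apply: contraNN AB => A'B.
  by apply/imfsetP; exists A'.
have wGfs j : fsupported (fun A => weight i j * G j A).
  by apply: fsupported_le (Gfs j) => A ->; rewrite mulr0.
have [wGS wGE] := fsupported_sum xpredT wGfs.
rewrite {1}/gencoef; under eq_fsbigr => A _ do rewrite mx_coef_mincr.
rewrite fsumD //; last first.
  by apply: fsupported_le (mx_coef_fsupp n (fun A => col_series A t m)) => A ->;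
    rewrite mulr0.
rewrite [X in _ + X]wGE.
have -> : \sum_(A \in [set: 'M[nat]_d])
      (i < k)%N%:R * (mx_coef n A * col_series A t m) =
    (i < k)%N%:R * gencoef n t m by rewrite /gencoef mulr_fsumr.
have -> : \sum_j \sum_(A \in [set: 'M[nat]_d]) weight i j * G j A =
    \sum_j weight i j * mulX j (gencoef n t.+1) m.
  by apply: eq_bigr => j _; rewrite -Gsum mulr_fsumr.
rewrite -mulL_gencoef /mulL mul1r.
rewrite mulrBr -addrA; congr (_ + _).
rewrite mulr_sumr -sumrN -sumrN -big_split; apply: eq_bigr => j _ /=.
by rewrite /weight /cutoff; ring.
Qed.

Lemma gencoef0 t m : gencoef midx0 t m = negbin (cutoff l) t m.
Proof.
rewrite /gencoef (@fsbigTE _ _ _ _ [fset 0]%fset) ?big_seq_fset1.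
  rewrite /mx_coef big1 ?mul1r /col_series.
    have -> : mxcols (0 : 'M[nat]_d) = midx0.
      by apply/ffunP => j; rewrite !ffunE big1 // => i _; rewrite mxE.
    by rewrite mulXn0 msize0 addn0.
  move=> i _; rewrite ffunE row_coef0; have -> : mxrow_idx 0 i = midx0;
    last by rewrite eqxx.
  by apply/ffunP => j; rewrite !ffunE mxE.
move=> A; rewrite in_fset1 => A0; rewrite /mx_coef.
have [i Ai] : exists i, mxrow_idx A i != midx0.
  apply/existsP; apply: contraNT A0; rewrite negb_exists => /forallP A0.
  apply/eqP/matrixP => i j; have /negPn/eqP/ffunP/(_ j) := A0 i.
  by rewrite !ffunE mxE.
by rewrite (bigD1 i) //= ffunE row_coef0 (negbTE Ai) !mul0r.
Qed.

End GeneratingFamily.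
Arguments cutoff {K d} k j.
Arguments col_series {K d} l A t _.

Section MeixnerFamily.
Variables (K : numFieldType) (d k l : nat) (U : 'M[K]_d).
Implicit Types (m n c : mindex d) (t : nat) (A : 'M[nat]_d) (i j : 'I_d).

Lemma prod_bool (I : finType) (P : I -> bool) (b : bool) :
  reflect (forall i : I, P i) b -> \prod_i (P i)%:R = b%:R :> K.
Proof.
case=> [PT|NP]; first by rewrite big1 // => i _; rewrite PT.
have /existsP[i Pi] : [exists i : I, ~~ P i].
  by rewrite -negb_forall; apply/negP => /forallP.
by rewrite (bigD1 i) //= (negbTE Pi) mul0r.
Qed.

(** The factors of the Meixner sum that depend on the column sums [c], up to
    sign, are a coefficient of [x^c L_0^(- t - |c|)]: split [(t)_|m|] as
    [(t)_|c| (t + |c|)_(|m| - |c|)]. The constraint on the columns [j >= l]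
    appears because [L_0] does not contain these variables. *)
Lemma mulXn_negbin c t m :
  mulXn c (negbin (cutoff l) (t + msize c)) m * poch t%:R (msize c) =
  poch t%:R (msize m) / (mfact m)%:R * (\prod_j (m j ^_ c j)%N%:R) *
  \prod_(j < d) ((l <= j)%N ==> (c j == m j))%:R :> K.
Proof.
rewrite /mulXn (prod_bool forallP).
have [/forallP cm|] := boolP [forall j, (c j <= m j)%N]; last first.
  rewrite negb_forall => /existsP[j]; rewrite -ltnNge => mc.
  by rewrite !mul0r [X in _ * X * _](bigD1 j) //= ffact_small // !(mulr0, mul0r).
set q := finfun _; rewrite mul1r.
have qE j : (m j = c j + q j)%N by rewrite ffunE subnKC.
have sE : msize m = (msize c + msize q)%N.
  by rewrite /msize -big_split; apply: eq_bigr => j _; rewrite qE.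
have fE : (\prod_j (m j ^_ c j)%N%:R) * (mfact q)%:R = (mfact m)%:R :> K.
  rewrite /mfact -natr_prod -natrM -big_split /=; congr (_%:R).
  by apply: eq_bigr => j _; rewrite ffunE ffact_fact.
have indE : mpow (cutoff l) q = \prod_(j < d) ((l <= j)%N ==> (c j == m j))%:R :> K.
  rewrite /mpow; apply: eq_bigr => j _; rewrite /cutoff (leqNgt l).
  case: (j < l)%N => /=; first by rewrite mulr1n expr1n.
  by rewrite mulr0n expr0n qE -[X in _ = (X == _)%:R]addn0 eqn_add2l eq_sym.
rewrite /negbin /egf indE sE pochD natrD -fE.
have : (\prod_j (m j ^_ c j)%N%:R) != 0 :> K.
  by apply/prodf_neq0 => j _; rewrite pnatr_eq0 -lt0n ffact_gt0.
by have := mfact_neq0 K q; move=> *; field; apply/andP.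
Qed.

(** The two sums agree term by term: the signs of the Pochhammer symbols
    cancel, because the row sums and the column sums of a matrix have the same
    total, and the constraints defining [Mkl] are carried by the coefficients
    on the left. *)
Lemma gencoef_hmeixner t m n : gencoef k l U n t.+1 m =
  poch t.+1%:R (msize m) / (mfact m)%:R * hmeixner k l t.+1%:R U m n.
Proof.
rewrite /hmeixner mulr_fsumr [in RHS]fsbig_mkcond; apply: eq_fsbigr => A _ /=.
rewrite /patch /mx_coef.
have rowE :
  \prod_(i < d) row_coef (i < k)%N (weight k l U i) (n i) (mxrow_idx A i) =
  (\prod_(i < d) (n i ^_ (\sum_j A i j))%N%:R) *
  (\prod_(i < d) \prod_(j < d) ((A i j)`!%:R)^-1) *
  (\prod_(i < d) \prod_(j < d) weight k l U i j ^+ A i j) *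
  \prod_(i < d) ((k <= i)%N ==> ((\sum_j A i j)%N == n i))%:R.
  rewrite -!big_split; apply: eq_bigr => i _ /=.
  rewrite /row_coef /egf msize_mxrow (leqNgt k) implyNb.
  have -> : (mfact (mxrow_idx A i))%:R^-1 = \prod_(j < d) ((A i j)`!%:R)^-1 :> K.
    rewrite /mfact natr_prod -prodfV; apply: eq_bigr => j _; by rewrite ffunE.
  have -> : mpow (weight k l U i) (mxrow_idx A i) =
      \prod_(j < d) weight k l U i j ^+ A i j.
    by apply: eq_bigr => j _; rewrite ffunE.
  by ring.
have weightE : \prod_(i < d) \prod_(j < d) weight k l U i j ^+ A i j =
  (\prod_(i < d | (i < k)%N) \prod_(j < d | (j < l)%N) (1 - U i j) ^+ A i j) *
     (\prod_(i < d) \prod_(j < d | (k <= i)%N || (l <= j)%N) (- U i j) ^+ A i j).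
  rewrite [X in X * _]big_mkcond -big_split; apply: eq_bigr => i _ /=.
  case: ltnP => ik /=; last first.
    by rewrite mul1r; apply: eq_bigr => j _; rewrite /weight ltnNge ik mul0r sub0r.
  rewrite (bigID (fun j : 'I_d => (j < l)%N)) /=; congr (_ * _).
    by apply: eq_bigr => j jl; rewrite /weight ik jl mul1r.
  apply: eq_big => [j|j jl]; first by rewrite -ltnNge ltnS.
  by rewrite /weight ik (negbTE jl) mulr0 sub0r.
have tN0 N : poch (t.+1%:R : K) N != 0 by rewrite lt0r_neq0 // poch_gt0.
have colE := mulXn_negbin (mxcols A) t.+1 m.
have {colE} : col_series l A t.+1 m =
  poch t.+1%:R (msize m) / (mfact m)%:R * (\prod_j (m j ^_ mxcols A j)%N%:R) *
  (\prod_(j < d) ((l <= j)%N ==> (mxcols A j == m j))%:R) /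
  poch (t.+1%:R : K) (msize (mxcols A)).
  by rewrite -colE mulfK.
move=> ->; rewrite rowE weightE msize_mxcols.
have signE : (\prod_(j < d) poch (- (m j)%:R) (\sum_(i < d) A i j)%N) *
     (\prod_(i < d) poch (- (n i)%:R) (\sum_(j < d) A i j)%N) =
  (\prod_j (m j ^_ mxcols A j)%N%:R) *
  (\prod_(i < d) (n i ^_ (\sum_j A i j))%N%:R) :> K.
  rewrite (eq_bigr (fun j =>
    (-1) ^+ (\sum_i A i j)%N * (m j ^_ mxcols A j)%N%:R)); last first.
    by move=> j _; rewrite poch_opp_nat ffunE.
  rewrite [X in _ * X = _](eq_bigr (fun i =>
    (-1) ^+ (\sum_j A i j)%N * (n i ^_ (\sum_j A i j))%N%:R)); last first.
    by move=> i _; rewrite poch_opp_nat.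
  rewrite !big_split /= -!expr_sum [X in (-1) ^+ X * _ * _]exchange_big /=.
  by rewrite mulrACA -exprD addnn -mul2n exprM sqrrN expr1n expr1n mul1r.
rewrite signE.
rewrite (prod_bool (asboolP _)).
rewrite [X in _ * X / poch _ (\sum_i _)%N](prod_bool (asboolP _)).
have AE : (A \in Mkl k l m n) =
    `[< forall i : 'I_d, (k <= i)%N ==> ((\sum_j A i j)%N == n i) >] &&
    `[< forall j : 'I_d, (l <= j)%N ==> (mxcols A j == m j) >].
  apply/idP/andP; rewrite inE => -[].
    move=> Arow Acol; split; apply/asboolP => i; apply/implyP => ki.
      by apply/eqP/Arow.
    by rewrite ffunE; apply/eqP/Acol.
  move=> /asboolP Arow /asboolP Acol; split => i ki.
    by have := Arow i; rewrite ki => /eqP.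
  by have := Acol i; rewrite ki ffunE => /eqP.
rewrite AE; case: `[< _ >]; case: `[< _ >]; rewrite /= ?mulr0n ?(mulr0, mul0r) //.
by rewrite !mulr1n; ring.
Qed.

(** Transposing the summation matrix exchanges the roles of [m] and [n]. *)
Lemma hmeixner_dual (s : K) m n : hmeixner k l s U m n = hmeixner l k s U^T n m.
Proof.
rewrite /hmeixner (reindex_fsbig (@trmx nat d d) (Mkl l k n m)); last first.
  split.
  - move=> A [Arow Acol]; split => i ?.
      by rewrite -Acol //; apply: eq_bigr => j _; rewrite mxE.
    by rewrite -Arow //; apply: eq_bigr => j _; rewrite mxE.
  - by move=> A B _ _; apply: trmx_inj.
  - move=> A [Arow Acol]; exists A^T; last by rewrite trmxK.
    split => i ?; first by rewrite -Acol //; apply: eq_bigr => j _; rewrite mxE.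
    by rewrite -Arow //; apply: eq_bigr => j _; rewrite mxE.
apply: eq_fsbigr => A _.
congr (_ * _ * _).
- congr (_ * _).
    congr (_ / _).
      rewrite mulrC; congr (_ * _); apply: eq_bigr => i _; congr (poch _ _);
      by apply: eq_bigr => j _; rewrite mxE.
    congr (poch _ _); rewrite exchange_big; apply: eq_bigr => i _.
    by apply: eq_bigr => j _; rewrite mxE.
  rewrite exchange_big; apply: eq_bigr => i _.
  by apply: eq_bigr => j _; rewrite mxE.
- rewrite exchange_big; apply: eq_bigr => i _.
  by apply: eq_bigr => j _; rewrite !mxE.
- rewrite [RHS](exchange_big_dep xpredT) //=; apply: eq_bigr => i _.
  apply: eq_big => j; first by rewrite orbC.
  by rewrite !mxE.
Qed.

End MeixnerFamily.

(** * Lowering operators and the difference equations *)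

Section LoweringOperators.
Variables (K : numFieldType) (d k l : nat) (U : 'M[K]_d).
Variables (w : 'I_d -> 'I_d -> K) (kap : 'I_d -> K).
Implicit Types (m n : mindex d) (t : nat) (i j r s : 'I_d).

(** [Uw] and [sumw] say that the constant vector field with components
    [(s < k)] and [w s j] kills the linear forms [L_0] and [L_r], [r != s],
    and takes a constant value on [L_s]. *)
Hypothesis Uw : forall r s,
  (s < k)%N%:R * (r < k)%N%:R - \sum_j U r j * w s j = - ((r == s)%:R * kap s).
Hypothesis sumw : forall s, (s < k)%N%:R - \sum_j cutoff l j * w s j = 0.

(** Hence it acts on the product of powers as [d/dL_s] does. *)
Lemma diffD_gencoef s n t m : diffD t (s < k)%N%:R (w s) (gencoef k l U n t) m =
  (n s)%:R * kap s * gencoef k l U (mdecr n s) t.+1 m.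
Proof.
elim/mindex_ind: n t m => [|n i IH] t m.
  rewrite (_ : gencoef _ _ _ _ _ = negbin (cutoff l) t); last first.
    by apply/funext => q; rewrite gencoef0.
  by rewrite diffD_negbin sumw ffunE; ring.
rewrite (_ : gencoef _ _ _ _ _ = mulL (i < k)%N%:R (U i) (gencoef k l U n t.+1));
  last first.
  by apply/funext => q; rewrite gencoef_mincr.
rewrite diffD_mulL Uw (_ : diffD _ _ _ _ =
  fun m => (n s)%:R * kap s * gencoef k l U (mdecr n s) t.+2 m); last first.
  by apply/funext => q; rewrite IH.
rewrite mulLZ -gencoef_mincr mincrE.
have [<-|is_] := eqVneq i s; last first.
  by rewrite mincr_mdecr // addn0 mulr0n; ring.
rewrite mincrK addn1 mulr1n -natr1.
by have [ni|ni] := posnP (n i); [rewrite ni|rewrite mdecrK //]; ring.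
Qed.

Lemma mulL_diffD_gencoef s n t m :
  mulL (s < k)%N%:R (U s) (diffD t (s < k)%N%:R (w s) (gencoef k l U n t)) m =
  (n s)%:R * kap s * gencoef k l U n t m.
Proof.
rewrite (_ : diffD _ _ _ _ = fun m => (n s)%:R * kap s *
  gencoef k l U (mdecr n s) t.+1 m); last first.
  by apply/funext => q; rewrite diffD_gencoef.
rewrite mulLZ -gencoef_mincr.
by have [ni|ni] := posnP (n s); [rewrite ni !mul0r|rewrite mdecrK].
Qed.

(** The coefficient of [L_s D_s G_n = n_s kap_s G_n] at [x^m], divided by
    [(sigma)_|m| / m!]. *)
Lemma hmeixner_difference t s m n :
  let M m := hmeixner k l t.+1%:R U m n in
  let chi : K := (s < k)%N%:R in
  kap s * (n s)%:R * M m =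
  (chi * (t.+1%:R + (msize m)%:R) + \sum_i U s i * w s i * (m i)%:R) * M m
  + \sum_i \sum_(j | i != j) w s i * U s j * (m j)%:R * M (mincr (mdecr m j) i)
  - chi * (\sum_i U s i * (m i)%:R * M (mdecr m i) +
           (t.+1%:R + (msize m)%:R) * \sum_i w s i * M (mincr m i)).
Proof.
move=> M chi; pose P (q : mindex d) : K := poch t.+1%:R (msize q) / (mfact q)%:R.
have SE q : gencoef k l U n t.+1 q = P q * M q by rewrite gencoef_hmeixner.
clearbody M.
have P0 q : P q != 0.
  by rewrite mulf_neq0 ?invr_eq0 ?mfact_neq0 // lt0r_neq0 // poch_gt0.
have PS (q : mindex d) i : (q i).+1%:R * P (mincr q i) =
  P q * (t.+1%:R + (msize q)%:R).
  rewrite /P msize_mincr mfact_mincr pochSr natrM.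
  have := mfact_neq0 K q; have : (q i).+1%:R != 0 :> K by rewrite pnatr_eq0.
  by move=> *; field; rewrite !nat1r; apply/andP.
have DE (q : mindex d) : diffD t.+1 chi (w s) (gencoef k l U n t.+1) q =
    P q * (t.+1%:R + (msize q)%:R) * (chi * M q - \sum_i w s i * M (mincr q i)).
  rewrite /diffD SE natrD mulrBr mulr_sumr; congr (_ - _); first by ring.
  by apply: eq_bigr => i _; rewrite /dX SE -(PS _ i); ring.
have XE j : mulX j (diffD t.+1 chi (w s) (gencoef k l U n t.+1)) m =
    P m * ((m j)%:R * (chi * M (mdecr m j) -
      \sum_i w s i * M (mincr (mdecr m j) i))).
  have [mj|mj] := posnP (m j); first by rewrite mulX0 // mj !(mul0r, mulr0).
  rewrite /mulX mj DE -(PS _ j) mdecrK // mdecrE eqxx subn1 prednK //.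
  by rewrite mulr1n; ring.
have := mulL_diffD_gencoef s n t.+1 m; rewrite -/chi /mulL DE SE => eqS.
apply: (mulfI (P0 m)).
rewrite (_ : P m * _ = (n s)%:R * kap s * (P m * M m)); last by ring.
rewrite -eqS; under [X in _ - X = _]eq_bigr do rewrite XE.
have -> : \sum_j U s j * (P m * ((m j)%:R * (chi * M (mdecr m j) -
      \sum_i w s i * M (mincr (mdecr m j) i)))) =
    P m * (chi * (\sum_i U s i * (m i)%:R * M (mdecr m i)) -
     \sum_i \sum_j w s i * U s j * (m j)%:R * M (mincr (mdecr m j) i)).
  rewrite exchange_big /= mulrBr !mulr_sumr -sumrB; apply: eq_bigr => j _.
  have -> : \sum_i w s i * U s j * (m j)%:R * M (mincr (mdecr m j) i) =
     U s j * (m j)%:R * \sum_i w s i * M (mincr (mdecr m j) i).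
    by rewrite mulr_sumr; apply: eq_bigr => i _; ring.
  ring.
have -> : \sum_i \sum_j w s i * U s j * (m j)%:R * M (mincr (mdecr m j) i) =
   (\sum_i U s i * w s i * (m i)%:R) * M m +
   \sum_i \sum_(j | i != j) w s i * U s j * (m j)%:R * M (mincr (mdecr m j) i).
  rewrite mulr_suml -big_split; apply: eq_bigr => i _ /=.
  rewrite (bigD1 i) //=; congr (_ + _); last by apply: eq_bigl => j; rewrite eq_sym.
  by have [mi|mi] := posnP (m i); [rewrite mi|rewrite mdecrK //]; ring.
have chi2 : chi * chi = chi.
  by rewrite /chi; case: (s < k)%N; rewrite ?mulr1n ?mulr0n ?mulr1 ?mulr0.
rewrite -[in RHS]chi2; ring : chi2.
Qed.

End LoweringOperators.

(** * Unconditional sums of complex families *)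

Section HasSum.
Variables (R : realType) (I : choiceType).
Implicit Types (f g : I -> R[i]) (s : R[i]) (A B : {fset I}).

Lemma has_sumP f s : has_sum f s <->
  forall e : R[i], 0 < e -> exists A, forall B, (A `<=` B)%fset ->
    `|s - \sum_(i <- B) f i| < e.
Proof.
have psE B : partial_sum f B = \sum_(i <- B) f i.
  by rewrite /partial_sum big_seq_fsetE.
have cvgR := @cvgrPdist_lt _ (R[i]^o) _ totally totally_filter (partial_sum f).
split.
  move=> fs e e0; have [A _ AP] := proj1 (cvgR s) fs e e0.
  by exists A => B AB; rewrite -psE; apply: AP.
move=> fs; apply: (proj2 (cvgR s)) => e e0.
have [A AP] := fs e e0.
by exists A => // B AB; rewrite /= psE; apply: AP.
Qed.

Lemma has_sum_unique f s s' : has_sum f s -> has_sum f s' -> s = s'.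
Proof.
move=> fs fs'.
exact: (@cvg_unique (R[i]^o) (@norm_hausdorff _ (R[i]^o)) (partial_sum f @ totally)
  (fmap_proper_filter (partial_sum f) totally_filter) s s' fs fs').
Qed.

Lemma has_sum_ext f g s : f =1 g -> has_sum f s -> has_sum g s.
Proof. by move=> /funext->. Qed.

Lemma has_sumD f g s s' : has_sum f s -> has_sum g s' ->
  has_sum (fun i => f i + g i) (s + s').
Proof.
move=> /has_sumP fs /has_sumP gs; apply/has_sumP => e e0.
have e2 : 0 < e / 2%:R by rewrite divr_gt0 // ltr0n.
have [A AP] := fs _ e2; have [B BP] := gs _ e2.
exists (A `|` B)%fset => C; rewrite fsubUset => /andP[/AP fC /BP gC].
rewrite big_split /= opprD addrACA [e]splitr.
by apply: le_lt_trans (ler_normD _ _) _; apply: ltrD.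
Qed.

Lemma has_sumZ f s a : has_sum f s -> has_sum (fun i => a * f i) (a * s).
Proof.
move=> fs; rewrite /has_sum (_ : partial_sum _ = (fun A => a * partial_sum f A)).
  exact: (@cvgZl_tmp _ (R[i]^o) _ totally totally_filter a (partial_sum f) s).
by apply/funext => A; rewrite /partial_sum mulr_sumr.
Qed.

Lemma has_sum0 : has_sum (fun _ : I => 0) (0 : R[i]).
Proof.
apply/has_sumP => e e0; exists fset0 => B _.
by rewrite big1 // subrr normr0.
Qed.

Lemma has_sum_sum (J : Type) (r : seq J) (P : pred J) (F : J -> I -> R[i])
    (S : J -> R[i]) :
  (forall j, P j -> has_sum (F j) (S j)) ->
  has_sum (fun i => \sum_(j <- r | P j) F j i) (\sum_(j <- r | P j) S j).
Proof.
move=> FS; elim: r => [|j r IH].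
  rewrite big_nil; apply: has_sum_ext has_sum0 => i; by rewrite big_nil.
rewrite big_cons; case: ifP => Pj; last first.
  by apply: has_sum_ext IH => i; rewrite big_cons Pj.
by apply: has_sum_ext (has_sumD (FS j Pj) IH) => i; rewrite big_cons Pj.
Qed.

Lemma has_sum_finite f A : (forall i, i \notin A -> f i = 0) ->
  has_sum f (\sum_(i <- A) f i).
Proof.
move=> f0; apply/has_sumP => e e0; exists A => B AB.
rewrite (_ : \sum_(i <- A) f i = \sum_(i <- B) f i) ?subrr ?normr0 //.
by apply: big_fset_incl => // i _ /f0.
Qed.

(** Reindexing along an injection that may miss some zero terms. *)
Lemma has_sum_reindex f (h : I -> I) s : injective h ->
  (forall i, ~ range h i -> f i = 0) ->
  has_sum (fun i => f (h i)) s -> has_sum f s.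
Proof.
move=> h_inj f0 /has_sumP fs; apply/has_sumP => e /fs[A AP].
exists [fset h i | i in A]%fset => B AB.
have finC : finite_set (h @^-1` [set` B]).
  by apply: finite_preimage; [move=> x y _ _; apply: h_inj|exact: finite_fset].
have CE i : (i \in fset_set (h @^-1` [set` B])) = (h i \in B).
  by rewrite in_fset_set //; apply/idP/idP; rewrite inE.
have := AP (fset_set (h @^-1` [set` B]));
  rewrite (_ : \sum_(i <- _) f (h i) = \sum_(i <- B) f i).
  apply; apply/fsubsetP => i iA; rewrite CE; apply: (fsubsetP AB).
  by apply/imfsetP; exists i.
have <- : \sum_(i <- [fset h i | i in fset_set (h @^-1` [set` B])]%fset) f i =
    \sum_(i <- fset_set (h @^-1` [set` B])) f (h i).
  by rewrite big_imfset //= => x y _ _; apply: h_inj.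
apply: big_fset_incl.
  by apply/fsubsetP => _ /imfsetP[i /= iC ->]; rewrite CE in iC.
move=> i iB iC; apply: f0 => -[j _ ji]; move/negP: iC; apply.
by apply/imfsetP; exists j => //=; rewrite CE ji.
Qed.

Lemma has_sum_nonneg (g : I -> R) (B : R) : (forall i, 0 <= g i) ->
  (forall A, \sum_(i <- A) g i <= B) ->
  exists s, has_sum (fun i => (g i)%:C) s.
Proof.
move=> g0 gB; pose E := [set \sum_(i <- A) g i | A in [set: {fset I}]].
have supE : has_sup E.
  split; first by exists (\sum_(i <- fset0) g i), fset0.
  by exists B => _ [A _ <-].
exists (sup E)%:C; apply/has_sumP => e e0.
have eE : e = (complex.Re e)%:C by rewrite RRe_real // gtr0_real.
have e0' : 0 < complex.Re e by move: e0; rewrite eE ltcR.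
have [_ [A _ <-] EA] := sup_adherent e0' supE.
exists A => C AC; rewrite -raddf_sum -raddfB /= normc_def /= expr0n addr0 sqrtr_sqr.
rewrite eE ltcR.
have CE : \sum_(i <- C) g i <= sup E.
  by apply: ub_le_sup => //; [case: supE|exists C].
rewrite ger0_norm ?subr_ge0 //.
have : \sum_(i <- A) g i <= \sum_(i <- C) g i.
  rewrite (big_fsetID _ (mem A) C) /=.
  rewrite (_ : [fset x in C | x \in A]%fset = A).
    by rewrite lerDl sumr_ge0.
  by apply/fsetP => x; rewrite !inE /=; apply/andP/idP => [[]//|xA]; split => //;
    apply: (fsubsetP AC).
lra.
Qed.

(** A real family [u] with [|u| <= g] is the difference of the nonnegative
    families [u + g] and [g]; a complex family is split into its real and
    imaginary parts. *)
Lemma has_sum_dominated f (g : I -> R) (B : R) :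
  (forall i, `|f i| <= (g i)%:C) ->
  (forall A, \sum_(i <- A) g i <= B) ->
  exists s, has_sum f s.
Proof.
move=> fg gB.
have reg i : `|complex.Re (f i)| <= g i.
  rewrite -lecR; apply: le_trans (fg i); rewrite normc_def lecR -sqrtr_sqr.
  by rewrite ler_wsqrtr // lerDl sqr_ge0.
have img i : `|complex.Im (f i)| <= g i.
  rewrite -lecR; apply: le_trans (fg i); rewrite normc_def lecR -sqrtr_sqr.
  by rewrite ler_wsqrtr // lerDr sqr_ge0.
have g0 i : 0 <= g i by apply: le_trans (reg i).
have [sg gs] := has_sum_nonneg g0 gB.
have real_case (u : I -> R) :
    (forall i, `|u i| <= g i) -> exists s, has_sum (fun i => (u i)%:C) s.
  move=> ug; have [||s us] := @has_sum_nonneg (fun i => u i + g i) (B + B).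
  - by move=> i; have := ug i; rewrite ler_norml; lra.
  - move=> A; rewrite big_split lerD //; apply: le_trans (gB A).
    by apply: ler_sum => i _; have := ug i; rewrite ler_norml; lra.
  exists (s + -1 * sg).
  apply: has_sum_ext (has_sumD us (has_sumZ (a := -1) gs)) => i.
  by rewrite raddfD /=; ring.
have [s1 f1] := real_case _ reg; have [s2 f2] := real_case _ img.
exists (s1 + 'i * s2).
apply: has_sum_ext (has_sumD f1 (has_sumZ (a := 'i) f2)) => i.
by rewrite [f i in RHS]complexE.
Qed.

Lemma has_sum_conj f s : has_sum f s -> has_sum (fun i => (f i)^*%R) (s^*)%R.
Proof.
move=> /has_sumP fs; apply/has_sumP => e /fs[A AP]; exists A => B /AP.
by rewrite -raddf_sum -raddfB norm_conjC.
Qed.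

(** Absolute summability, in the form in which it is verified. The majorant and
    the bound are taken in [R[i]], where comparing with [0] forces them to be
    real. *)
Definition dominated f := exists (g : I -> R[i]) (B : R[i]),
  (forall i, `|f i| <= g i) /\ (forall A, \sum_(i <- A) g i <= B).

Lemma has_sum_exists f : dominated f -> exists s, has_sum f s.
Proof.
move=> [g [B [fg gB]]].
have g0 i : 0 <= g i by apply: le_trans (fg i).
have gE i : (complex.Re (g i))%:C = g i by rewrite RRe_real // ger0_real.
have B0 : 0 <= B by have := gB fset0; rewrite big_nil.
have BE : (complex.Re B)%:C = B by rewrite RRe_real // ger0_real.
apply: (@has_sum_dominated _ (fun i => complex.Re (g i)) (complex.Re B)) => [i|A].
  by rewrite gE.
rewrite -lecR BE raddf_sum; apply: le_trans (gB A).
by rewrite (eq_bigr g) // => i _; exact: gE.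
Qed.

Lemma dominated_reindex f (h : I -> I) : injective h ->
  dominated f -> dominated (fun i => f (h i)).
Proof.
move=> h_inj [g [B [fg gB]]]; exists (fun i => g (h i)), B; split => // A.
apply: le_trans (gB [fset h i | i in A]%fset).
by rewrite big_imfset //= => x y _ _; apply: h_inj.
Qed.

End HasSum.

(** * The generating function *)

Section NegativeBinomialBound.
Variables (K : numFieldType) (d : nat).
Implicit Types (f : mindex d -> K) (x : 'I_d -> K) (m : mindex d) (j : 'I_d).

Lemma mindex_box N : exists B : {fset mindex d},
  forall m, (m \in B) = [forall j, (m j <= N)%N].
Proof.
exists [fset [ffun j => nat_of_ord ((q : {ffun 'I_d -> 'I_N.+1}) j)] |
  q in {ffun 'I_d -> 'I_N.+1}]%fset => m.
apply/imfsetP/forallP => [[q _ ->] j|mN]; first by rewrite ffunE -ltnS.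
exists [ffun j => inord (m j)] => //.
by apply/ffunP => j; rewrite !ffunE inordK // ltnS.
Qed.

Lemma mincr_inj j : injective (fun m => mincr m j).
Proof. exact: can_inj (mincrK j). Qed.

(** Lowering the entry [j] maps the indices of the nonzero terms on the left
    injectively into [B]. *)
Lemma sum_mulX_le f (B : {fset mindex d}) j : (forall m, 0 <= f m) ->
  (forall m, m \in B -> mdecr m j \in B) ->
  \sum_(m <- B) mulX j f m <= \sum_(m <- B) f m.
Proof.
move=> f0 Bdecr.
rewrite (big_fsetID _ (fun m => (0 < m j)%N)) /=.
rewrite [X in _ + X]big1_seq ?addr0; last first.
  by move=> m /andP[_]; rewrite !inE /= -eqn0Ngt => /andP[_ /eqP mj]; rewrite mulX0.
set B' := [fset m in B | (0 < m j)%N]%fset.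
have -> : \sum_(m <- B') mulX j f m =
  \sum_(m <- [fset mdecr m j | m in B']%fset) f m.
  rewrite [RHS]big_imfset /=.
    apply: eq_big_seq => m; rewrite !inE => /andP[_ mj].
    by rewrite /mulX mj mul1r.
  move=> m m'; rewrite !inE => /andP[_ mj] /andP[_ mj'] mm'.
  by rewrite -(mdecrK mj) -(mdecrK mj') mm'.
rewrite [leRHS](big_fsetID _ (mem [fset mdecr m j | m in B']%fset)) /=.
rewrite (_ : [fset m in B | m \in [fset mdecr m j | m in B']]%fset =
   [fset mdecr m j | m in B']%fset).
  by rewrite lerDl sumr_ge0.
apply/fsetP => m; rewrite !inE /=; apply/andP/idP => [[]//|mB]; split => //.
by move: mB => /imfsetP[q]; rewrite /= !inE => /andP[/Bdecr ? _ ->].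
Qed.

Lemma negbin_ge0 x t m : (forall j, 0 <= x j) -> 0 <= negbin x t m.
Proof.
move=> x0; rewrite /negbin /egf mulr_ge0 ?divr_ge0 ?poch_ge0 ?ler0n //.
by apply: prodr_ge0 => j _; rewrite exprn_ge0.
Qed.

Lemma negbin_0 x m : negbin x 0 m = (m == midx0)%:R.
Proof.
have [->|m0] := eqVneq m midx0; first by rewrite negbin0.
rewrite /negbin /egf; case: (msize m) (@msize_eq0 _ m) => [/(_ erefl)/eqP|M _].
  by rewrite (negbTE m0).
by rewrite pochS !mul0r.
Qed.

(** On a set [B] of multi-indices closed under lowering entries, the identity
    [negbin x t.+1 = negbin x t + sum_j x_j mulX j (negbin x t.+1)] gives
    [S_(t+1) <= S_t + (sum_j x_j) S_(t+1)] for the partial sums, which bounds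
    them by induction on [t]. *)
Lemma negbin_bounded x t (A : {fset mindex d}) : (forall j, 0 <= x j) ->
  \sum_j x j < 1 -> \sum_(m <- A) negbin x t m <= (1 - \sum_j x j) ^- t.
Proof.
move=> x0 x1; have X0 : 0 < 1 - \sum_j x j by rewrite subr_gt0.
have [B BE] : exists B : {fset mindex d}, [/\ (A `<=` B)%fset, midx0 \in B &
    forall m j, m \in B -> mdecr m j \in B].
  have [B BE] := mindex_box (\sum_(m <- A) msize m)%N; exists B; split.
  - apply/fsubsetP => m mA; rewrite BE; apply/forallP => j.
    rewrite (big_fsetD1 m) //=; apply: leq_trans (leq_addr _ _).
    by rewrite /msize (bigD1 j) //= leq_addr.
  - by rewrite BE; apply/forallP => j; rewrite ffunE.
  - move=> m j; rewrite !BE => /forallP mN; apply/forallP => i.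
    by rewrite mdecrE; apply: leq_trans (leq_subr _ _) (mN i).
case: BE => AB B0 Bdecr.
apply: (@le_trans _ _ (\sum_(m <- B) negbin x t m)).
  rewrite [leRHS](big_fsetID _ (mem A)) /= (_ : [fset m in B | m \in A]%fset = A).
    by rewrite lerDl sumr_ge0 // => m _; apply: negbin_ge0.
  by apply/fsetP => m; rewrite !inE /=; apply/andP/idP => [[]//|mA]; split => //;
    apply: (fsubsetP AB).
elim: t {A AB} => [|t IH].
  rewrite expr0 invr1 (big_fsetD1 midx0) //= negbin0 big1_seq ?addr0 //.
  by move=> m /andP[_]; rewrite !inE negbin_0 => /andP[/negbTE->].
have sE : \sum_(m <- B) negbin x t.+1 m =
   \sum_(m <- B) negbin x t m + \sum_j x j * \sum_(m <- B) mulX j (negbin x t.+1) m.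
  have -> : \sum_j x j * \sum_(m <- B) mulX j (negbin x t.+1) m =
     \sum_(m <- B) \sum_j x j * mulX j (negbin x t.+1) m.
    by rewrite exchange_big; apply: eq_bigr => j _; rewrite mulr_sumr.
  by rewrite -big_split; apply: eq_bigr => m _ /=;
    rewrite -(mulL_negbin x t m) /mulL mul1r subrK.
have sle : \sum_j x j * \sum_(m <- B) mulX j (negbin x t.+1) m <=
    (\sum_j x j) * \sum_(m <- B) negbin x t.+1 m.
  rewrite mulr_suml; apply: ler_sum => j _; rewrite ler_wpM2l //.
  by apply: sum_mulX_le => // [m|m /Bdecr //]; apply: negbin_ge0.
have : (1 - \sum_j x j) * \sum_(m <- B) negbin x t.+1 m <= (1 - \sum_j x j) ^- t.
  apply: le_trans IH; rewrite mulrBl mul1r {1}sE lerBlDr lerD2l //.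
by rewrite exprS invfM ler_pdivlMl.
Qed.

End NegativeBinomialBound.

Section GeneratingFunction.
Variables (R : realType) (d : nat).
Implicit Types (f : mindex d -> R[i]) (y : 'I_d -> R[i]) (m n : mindex d)
  (j : 'I_d).

Lemma mincr_range j m : ~ range (fun m => mincr m j) m -> m j = 0%N.
Proof.
by move=> mj; apply/eqP; rewrite -leqn0 leqNgt; apply/negP => /mdecrK mE;
  apply: mj; exists (mdecr m j).
Qed.

Lemma has_sum_mulX j f s : has_sum f s -> has_sum (mulX j f) s.
Proof.
move=> fs; apply: (has_sum_reindex (@mincr_inj d j)).
  by move=> m /mincr_range mj; rewrite mulX0.
by apply: has_sum_ext fs => m; rewrite mulX_mincr.
Qed.

Lemma has_sum_mulL c u f s : has_sum f s ->
  has_sum (mulL c u f) ((c - \sum_j u j) * s).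
Proof.
move=> fs; rewrite mulrBl mulr_suml -[X in _ - X]mul1r -mulNr.
apply: has_sum_ext (has_sumD (has_sumZ (a := c) fs) (has_sumZ (a := -1)
  (has_sum_sum (r := index_enum _) (P := xpredT)
    (fun j _ => has_sumZ (a := u j) (has_sum_mulX j fs))))) => m.
by rewrite mulN1r.
Qed.

Lemma dominated_negbin y t : \sum_j `|y j| < 1 -> dominated (negbin y t).
Proof.
move=> y1; exists (negbin (fun j => `|y j|) t), ((1 - \sum_j `|y j|) ^- t); split.
  move=> m; rewrite /negbin /egf normrM ger0_norm ?divr_ge0 ?poch_ge0 ?ler0n //.
  by rewrite /mpow normr_prod; under eq_bigr do rewrite normrX.
by move=> A; apply: negbin_bounded.
Qed.

(** Once the sum exists, [mulL_negbin] forces its value. *)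
Lemma has_sum_negbin y t : \sum_j `|y j| < 1 ->
  has_sum (negbin y t) ((1 - \sum_j y j) ^- t).
Proof.
move=> y1; have Y0 : 1 - \sum_j y j != 0.
  rewrite subr_eq0; apply: contraTneq y1 => Y1.
  rewrite real_ltNge ?num_real ?ger0_real ?sumr_ge0 // negbK.
  by rewrite -[1]normr1 Y1 ler_norm_sum.
elim: t => [|t IH].
  rewrite expr0 invr1.
  have := @has_sum_finite R _ (negbin y 0) [fset midx0]%fset.
  rewrite big_seq_fset1 negbin0; apply=> m;
    rewrite in_fset1 negbin_0 => /negbTE-> //.
have [s sE] := has_sum_exists (dominated_negbin t.+1 y1).
have := has_sum_mulL (c := 1) (u := y) sE; rewrite (_ : mulL _ _ _ = negbin y t);
  last first.
  by apply/funext => m; rewrite mulL_negbin.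
move=> /has_sum_unique/(_ IH) sV.
by rewrite exprS invfM mulrC -sV mulrC mulKf.
Qed.

Lemma mulX_mpow j f y m :
  mulX j f m * mpow y m = y j * mulX j (fun m => f m * mpow y m) m.
Proof.
have [mj|mj] := posnP (m j); first by rewrite !mulX0 // mul0r mulr0.
by rewrite /mulX mj -{2}(mdecrK mj) mpow_mincr; ring.
Qed.

Lemma has_sum_gencoef k l (U : 'M[R[i]]_d) n t y :
  \sum_j `|cutoff l j * y j| < 1 ->
  has_sum (fun m => gencoef k l U n t m * mpow y m)
    ((1 - \sum_j cutoff l j * y j) ^- (t + msize n) *
     \prod_(i < d) ((i < k)%N%:R - \sum_j U i j * y j) ^+ n i).
Proof.
move=> y1; elim/mindex_ind: n t => [|n i IH] t.
  rewrite msize0 addn0 [X in _ * X]big1 ?mulr1; last by move=> i _; rewrite ffunE.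
  apply: has_sum_ext (has_sum_negbin (t := t) y1) => m;
    rewrite gencoef0 /negbin /egf -[RHS]mulrA.
  by congr (_ * _); rewrite /mpow; under eq_bigr do rewrite exprMn;
    rewrite big_split.
have -> : \prod_(s < d) ((s < k)%N%:R - \sum_j U s j * y j) ^+ mincr n i s =
  ((i < k)%N%:R - \sum_j U i j * y j) *
  \prod_(s < d) ((s < k)%N%:R - \sum_j U s j * y j) ^+ n s.
  exact: (mpow_mincr (fun s : 'I_d => (s < k)%N%:R - \sum_j U s j * y j)).
rewrite msize_mincr mulrCA -addSnnS.
apply: has_sum_ext (has_sum_mulL (c := (i < k)%N%:R) (u := fun j => U i j * y j)
  (IH t.+1)) => m.
rewrite gencoef_mincr /mulL /= mulrBl [X in _ = _ - X]mulr_suml mulrA;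
  congr (_ - _).
by apply: eq_bigr => j _; rewrite -[RHS]mulrA mulX_mpow; exact: esym (mulrA _ _ _).
Qed.

End GeneratingFunction.

(** * Majorants for the coefficients *)

Section TameFamilies.
Variables (K : numFieldType) (d l : nat).
Implicit Types (f g : mindex d -> K) (m n : mindex d) (i j : 'I_d) (N b t : nat).

Definition tail m : nat := \sum_(j < d | (l <= j)%N) m j.

(** Up to a constant, the general shape of the coefficients of a polynomial
    times a power of [L_0]: degrees in the variables absent from [L_0] stay
    bounded, and those in the others grow as in a negative binomial series. *)
Definition envelope N b : mindex d -> K :=
  fun m => poch N.+1%:R (msize m) / (mfact m)%:R * (tail m <= b)%N%:R.

Definition tame f := exists (C : K) (N b : nat),
  0 <= C /\ forall m, `|f m| <= C * envelope N b m.

Lemma ler_poch a b M : (a <= b)%N -> poch (a%:R : K) M <= poch b%:R M.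
Proof.
move=> ab; apply: ler_prod => i _; rewrite -!natrD ler_nat ler0n /=.
by rewrite leq_add2r.
Qed.

Lemma envelope_ge0 N b m : 0 <= envelope N b m.
Proof. by rewrite /envelope mulr_ge0 ?divr_ge0 ?poch_ge0 ?ler0n. Qed.

Lemma envelope_le N N' b b' m : (N <= N')%N -> (b <= b')%N ->
  envelope N b m <= envelope N' b' m.
Proof.
move=> NN bb; rewrite /envelope ler_pM ?divr_ge0 ?poch_ge0 ?ler0n //.
  by rewrite ler_pM2r ?invr_gt0 ?ltr0n ?mfact_gt0 // ler_poch.
by rewrite ler_nat; case: (leqP (tail m) b) => // mb; rewrite (leq_trans mb bb).
Qed.

Lemma tameZ a f : tame f -> tame (fun m => a * f m).
Proof.
move=> [C [N [b [C0 fC]]]]; exists (`|a| * C), N, b; split=> [|m].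
  by rewrite mulr_ge0.
by rewrite normrM -mulrA ler_wpM2l.
Qed.

Lemma tameD f g : tame f -> tame g -> tame (fun m => f m + g m).
Proof.
move=> [C [N [b [C0 fC]]]] [C' [N' [b' [C'0 gC]]]].
exists (C + C'), (maxn N N'), (maxn b b'); split=> [|m]; first exact: addr_ge0.
apply: le_trans (ler_normD _ _) _; rewrite mulrDl lerD //.
  apply: le_trans (fC m) _; rewrite ler_wpM2l // envelope_le ?leq_maxl //.
apply: le_trans (gC m) _; rewrite ler_wpM2l // envelope_le ?leq_maxr //.
Qed.

Lemma tame_sum (F : 'I_d -> mindex d -> K) :
  (forall j, tame (F j)) -> tame (fun m => \sum_j F j m).
Proof.
move=> Ft; elim: index_enum => [|j s IH].
  exists 0, 0%N, 0%N; split=> // m; by rewrite big_nil normr0 mul0r.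
rewrite (_ : (fun m => _) = fun m => F j m + \sum_(j <- s) F j m).
  exact: tameD.
by apply/funext => m; rewrite big_cons.
Qed.

(** The same [N] works because [m_j <= N + |m|]. *)
Lemma tame_mulX j f : tame f -> tame (mulX j f).
Proof.
move=> [C [N [b [C0 fC]]]]; exists C, N, b.+1; split=> // m.
have [mj|mj] := posnP (m j).
  by rewrite mulX0 // normr0 mulr_ge0 // envelope_ge0.
have [q ->] : exists q, m = mincr q j by exists (mdecr m j); rewrite mdecrK.
rewrite mulX_mincr; apply: le_trans (fC q) _; rewrite ler_wpM2l //.
rewrite /envelope msize_mincr mfact_mincr pochSr ler_pM ?divr_ge0 ?poch_ge0
  ?ler0n //.
  rewrite natrM invfM [X in _ <= _ * X]mulrC mulrA.
  rewrite [X in _ <= X / _]mulrAC -[leRHS]mulrA.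
  apply: ler_peMr; first by rewrite divr_ge0 ?poch_ge0 ?ler0n.
  rewrite ler_pdivlMr ?ltr0n // mul1r -natrD ler_nat addSn ltnS.
  by apply: leq_trans (leq_addl _ _); rewrite /msize (bigD1 j) //= leq_addr.
rewrite ler_nat; case: (leqP (tail q)) => // qb.
rewrite (_ : (_ <= b.+1)%N = true) //;
  apply: leq_trans (_ : (tail q).+1 <= _)%N => //.
rewrite /tail; case: (leqP l j) => lj.
  rewrite (bigD1 j) //= [in leqRHS](bigD1 j) //= mincrE eqxx addn1 addSn.
  by rewrite (eq_bigr q) // => i /andP[_ /negbTE ij]; rewrite mincrE ij addn0.
rewrite (eq_bigr q) // => i li; rewrite mincrE.
by case: eqP => [ij|]; [move: lj; rewrite -ij ltnNge li|rewrite addn0].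
Qed.

Lemma tame_mulL c u f : tame f -> tame (mulL c u f).
Proof.
move=> ft; rewrite (_ : mulL _ _ _ =
  fun m => c * f m + \sum_j (- u j) * mulX j f m).
  by apply: tameD; [exact: tameZ|apply: tame_sum => j; apply: tameZ;
    exact: tame_mulX].
apply/funext => m; rewrite /mulL -sumrN; congr (_ + _).
by apply: eq_bigr => j _; rewrite mulNr.
Qed.

Lemma mpow_cutoff m : mpow (cutoff l) m = (tail m == 0)%N%:R :> K.
Proof.
rewrite /mpow; have [t0|] := eqVneq (tail m) 0%N.
  rewrite big1 // => j _; rewrite /cutoff; case: ltnP => lj;
    first by rewrite expr1n.
  move/eqP: t0; rewrite sum_nat_eq0 => /forallP/(_ j); rewrite lj => /eqP->.
  by rewrite expr0.
rewrite sum_nat_eq0 negb_forall => /existsP[j]; rewrite negb_imply => /andP[lj mj].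
by rewrite (bigD1 j) //= /cutoff ltnNge lj expr0n (negbTE mj) mul0r.
Qed.

Lemma tame_negbin t : tame (negbin (cutoff l) t).
Proof.
exists 1, t, 0%N; split=> // m;
  rewrite mul1r /negbin /egf mpow_cutoff /envelope leqn0.
rewrite ger0_norm ?mulr_ge0 ?divr_ge0 ?poch_ge0 ?ler0n // ler_wpM2r ?ler0n //.
by rewrite ler_pM2r ?invr_gt0 ?ltr0n ?mfact_gt0 // ler_poch.
Qed.

Lemma tame_gencoef k (U : 'M[K]_d) n t : tame (gencoef k l U n t).
Proof.
elim/mindex_ind: n t => [|n i IH] t.
  rewrite (_ : gencoef _ _ _ _ _ = negbin (cutoff l) t); first exact: tame_negbin.
  by apply/funext => m; rewrite gencoef0.
rewrite (_ : gencoef _ _ _ _ _ = mulL (i < k)%N%:R (U i) (gencoef k l U n t.+1)).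
  exact: tame_mulL.
by apply/funext => m; rewrite gencoef_mincr.
Qed.

(** Factor by factor, [(a+1+i)(b+1+i) <= (1+i)((a+1)(b+1)+i)], the difference
    being [i a b]. *)
Lemma poch_mul_le (a b M : nat) :
  poch (a.+1%:R : K) M * poch b.+1%:R M <= poch 1 M * poch (a.+1 * b.+1)%:R M.
Proof.
rewrite /poch -!big_split; apply: ler_prod => i _ /=;
  rewrite -!natrD -natrM ler0n /=.
rewrite nat1r -natrM ler_nat.
nia.
Qed.

End TameFamilies.

(** * Adjointness and orthogonality *)

Section Orthogonality.
Variables (R : realType) (d k l : nat) (U : 'M[R[i]]_d).
Variables (q : 'I_d -> R[i]) (kap : 'I_d -> R[i]) (c : R[i]).
Implicit Types (f g h : mindex d -> R[i]) (m n : mindex d) (i j s : 'I_d) (t : nat).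

Hypothesis q_gt0 : forall j, 0 < q j.
Hypothesis c_gt0 : 0 < c.
Hypothesis kap_real : forall s, kap s \is Num.real.
Hypothesis sumq : 1 - \sum_j cutoff l j * q j = c.

Let w s j := q j * (U s j)^*%R.

Hypothesis Uw : forall r s : 'I_d,
  (s < k)%N%:R * (r < k)%N%:R - \sum_j U r j * w s j = - ((r == s)%:R * kap s).
Hypothesis sumw : forall s : 'I_d, (s < k)%N%:R - \sum_j cutoff l j * w s j = 0.

(** The squared norm of the monomial with exponent [m], for the parameter [t]. *)
Definition norm_weight t m : R[i] := (mfact m)%:R / poch t%:R (msize m) * mpow q m.

Lemma norm_weight_ge0 t m : 0 <= norm_weight t m.
Proof.
rewrite /norm_weight mulr_ge0 ?divr_ge0 ?poch_ge0 ?ler0n //.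
by apply: prodr_ge0 => j _; rewrite exprn_ge0 // ltW.
Qed.

Lemma poch_neq0 t M : poch (t.+1%:R : R[i]) M != 0.
Proof. by rewrite lt0r_neq0 // poch_gt0. Qed.

Lemma norm_weight_raise t m :
  t.+1%:R * norm_weight t.+1 m = norm_weight t.+2 m * (t.+1%:R + (msize m)%:R).
Proof.
have key : poch (t.+1%:R : R[i]) (msize m) * (t.+1%:R + (msize m)%:R) =
   t.+1%:R * poch t.+2%:R (msize m) by rewrite -pochSr pochS natr1.
have p1 := poch_neq0 t (msize m); have p2 := poch_neq0 t.+1 (msize m).
rewrite /norm_weight; apply: (mulfI p1); apply: (mulfI p2).
transitivity (t.+1%:R * poch t.+2%:R (msize m) * ((mfact m)%:R * mpow q m)).
  by field.
by rewrite -key; field.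
Qed.

Lemma norm_weight_mincr t m j :
  t.+1%:R * norm_weight t.+1 (mincr m j) = q j * (m j).+1%:R * norm_weight t.+2 m.
Proof.
rewrite /norm_weight msize_mincr mfact_mincr mpow_mincr pochS natr1 natrM.
have p2 := poch_neq0 t.+1 (msize m);
  have t0 : t.+1%:R != 0 :> R[i] by rewrite pnatr_eq0.
by field; rewrite nat1r; apply/andP.
Qed.

(** The product of the two envelopes with the weight is at most
    [(D)_|m| / m! q^m], with [m] of bounded degree in the variables [j >= l].
    The weights [q_j] of these variables may be large, but because of the
    bounded degree they can be scaled down by [dl] at the cost of a constant;
    then the sum of all weights is less than [1], and a convergent negative
    binomial series remains. *)
Lemma dominated_pair f g t : tame l f -> tame l g ->
  dominated (fun m => norm_weight t.+1 m * f m * (g m)^*%R).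
Proof.
move=> [C [N [b [C0 fC]]]] [C' [N' [b' [C'0 gC]]]].
pose Q := \sum_j q j; have Q0 : 0 <= Q by apply: sumr_ge0 => j _; apply: ltW.
have c1 : c <= 1.
  by rewrite -sumq gerBl sumr_ge0 // => j _; rewrite mulr_ge0 ?ler0n // ltW.
(* The weights of the variables in L_0 have sum 1 - c, so it is enough that the
   others, scaled by dl, contribute less than c. *)
pose dl := c / (2%:R * (1 + Q)).
have Q1 : 0 < 1 + Q by rewrite ltr_wpDr.
have dl0 : 0 < dl by rewrite divr_gt0 // mulr_gt0 // ltr0n.
have dl1 : dl <= 1.
  rewrite /dl ler_pdivrMr ?mulr_gt0 ?ltr0n // mul1r (le_trans c1) //.
  by rewrite mulr_natl mulr2n ler_wpDr ?(ltW Q1) // lerDl.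
pose y (j : 'I_d) := (if (j < l)%N then 1 else dl) * q j.
have y0 j : 0 <= y j by rewrite mulr_ge0 ?(ltW (q_gt0 j)) //; case: ifP;
  rewrite ?ltW.
have y1 : \sum_j y j < 1.
  have : \sum_j y j <= \sum_j (cutoff l j * q j + dl * q j).
    apply: ler_sum => j _; rewrite /y /cutoff; case: ifP => _.
      by rewrite lerDl mulr_ge0 ?ltW.
    by rewrite mul0r add0r.
  move=> /le_lt_trans; apply; rewrite big_split /= -mulr_sumr -/Q.
  have -> : \sum_j cutoff l j * q j = 1 - c by rewrite -sumq opprB addrC subrK.
  rewrite -addrA gtrDl addrC subr_lt0 /dl mulrAC ltr_pdivrMr ?mulr_gt0 ?ltr0n //.
  by rewrite ltr_pM2l // mulr_natl mulr2n ltr_pwDl // lerDr.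
pose D := (N.+1 * N'.+1)%N.
exists (fun m => C * C' * dl ^- b * negbin y D m),
  (C * C' * dl ^- b * (1 - \sum_j y j) ^- D).
split=> [m|A]; last first.
  rewrite -mulr_sumr ler_wpM2l ?negbin_bounded // ?mulr_ge0 // invr_ge0.
  by rewrite exprn_ge0 // ltW.
have qE : mpow q m * (tail l m <= b)%N%:R <= dl ^- b * mpow y m.
  have mpy : mpow y m = dl ^+ tail l m * mpow q m.
    rewrite /mpow
      (eq_bigr (fun j => (if (j < l)%N then 1 else dl) ^+ m j * q j ^+ m j)).
      rewrite big_split /=; congr (_ * _).
      rewrite (bigID (fun j : 'I_d => (j < l)%N)) /= big1 ?mul1r; last first.
        by move=> j ->; rewrite expr1n.
      rewrite /tail expr_sum; apply: eq_big => [j|j /negbTE->//].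
      by rewrite -leqNgt.
    by move=> j _; rewrite exprMn.
  have mq0 : 0 <= mpow q m by apply: prodr_ge0 => j _; rewrite exprn_ge0 // ltW.
  rewrite mpy; case: leqP => tb; last first.
    by rewrite mulr0 !mulr_ge0 // ?invr_ge0 exprn_ge0 // ltW.
  rewrite mulr1 mulrA ler_peMl // mulrC ler_pdivlMr ?exprn_gt0 // mul1r.
  by rewrite ler_wiXn2l // ltW.
rewrite normrM norm_conjC normrM (ger0_norm (norm_weight_ge0 _ _)).
apply: (@le_trans _ _
  (norm_weight t.+1 m * (C * envelope _ l N b m) * (C' * envelope _ l N' b' m))).
  apply: ler_pM => //; first by rewrite mulr_ge0 ?norm_weight_ge0.
  by apply: ler_wpM2l; rewrite ?norm_weight_ge0.
rewrite /norm_weight /envelope.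
set M := msize m; set fm := (mfact m)%:R; set pq := mpow q m.
have fm0 : 0 < fm by rewrite ltr0n mfact_gt0.
have pqb0 : 0 <= pq * (tail l m <= b)%N%:R.
  by rewrite mulr_ge0 ?ler0n //; apply: prodr_ge0 => j _; rewrite exprn_ge0 // ltW.
have t0 : 0 < poch (t.+1%:R : R[i]) M := poch_gt0 _ _ _.
have pD : poch (N.+1%:R : R[i]) M * poch N'.+1%:R M <= poch t.+1%:R M * poch D%:R M.
  apply: le_trans (poch_mul_le _ _ _ _) _; rewrite ler_wpM2r ?poch_ge0 //.
  exact: (@ler_poch _ 1 t.+1).
rewrite [leLHS](_ : _ =
  (C * C') * ((poch N.+1%:R M * poch N'.+1%:R M / (poch t.+1%:R M * fm)) *
   ((pq * (tail l m <= b)%N%:R) * (tail l m <= b')%N%:R))); last first.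
  by field; rewrite !lt0r_neq0.
rewrite (_ : C * C' * dl ^- b * negbin y D m =
  (C * C') * ((poch D%:R M / fm) * (dl ^- b * mpow y m))); last first.
  by rewrite /negbin /egf -/M -/fm; ring.
apply: ler_wpM2l; first exact: mulr_ge0.
apply: ler_pM.
- by rewrite divr_ge0 ?mulr_ge0 ?poch_ge0 // ltW.
- by rewrite mulr_ge0 ?ler0n.
- rewrite ler_pdivrMr ?mulr_gt0 // mulrA mulrAC divfK ?lt0r_neq0 //.
  by rewrite [leRHS]mulrC.
- apply: le_trans qE; rewrite -[leRHS]mulr1 ler_wpM2l //.
  by rewrite lern1 leq_b1.
Qed.

Lemma mincr_shift_pair t j h g m :
  norm_weight t.+1 (mincr m j) * mulX j h (mincr m j) * (g (mincr m j))^*%R =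
  q j / t.+1%:R * (norm_weight t.+2 m * h m * (dX j g m)^*%R).
Proof.
have t0 : t.+1%:R != 0 :> R[i] by rewrite pnatr_eq0.
rewrite mulX_mincr /dX rmorphM /= conjC_nat; apply: (mulfI t0).
transitivity (t.+1%:R * norm_weight t.+1 (mincr m j) * (h m * (g (mincr m j))^*%R)).
  by ring.
by rewrite norm_weight_mincr; field; rewrite nat1r.
Qed.

(** Multiplication by [1] and by [x_j], as maps from parameter [t + 1] to
    parameter [t], have the adjoints [(t + E) / t] and [q_j / t * d/dx_j]
    ([norm_weight_raise], [mincr_shift_pair]). Combining them linearly, [L_s] has
    adjoint [D_s / t]. The separate pairings converge, so that the linear
    combinations of sums are legitimate. *)
Lemma adjoint_pair s t h g S : tame l h -> tame l g ->
  has_sum (fun m => norm_weight t.+2 m * h m *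
    (diffD t.+1 (s < k)%N%:R (w s) g m)^*%R) S ->
  has_sum (fun m => norm_weight t.+1 m * mulL (s < k)%N%:R (U s) h m *
    (g m)^*%R) (S / t.+1%:R).
Proof.
move=> th tg hS; have t0 : t.+1%:R != 0 :> R[i] by rewrite pnatr_eq0.
have [s0 s0E] := has_sum_exists (dominated_pair t th tg).
have sjX j : exists sj,
    has_sum (fun m => norm_weight t.+1 (mincr m j) * mulX j h (mincr m j) *
      (g (mincr m j))^*%R) sj.
  apply: has_sum_exists; apply: (dominated_reindex
    (f := fun m => norm_weight t.+1 m * mulX j h m * (g m)^*%R) (@mincr_inj d j)).
  by apply: dominated_pair => //; apply: tame_mulX.
have [sj sjE] := choice sjX.
have XE j : has_sum (fun m => norm_weight t.+1 m * mulX j h m * (g m)^*%R) (sj j).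
  apply: (has_sum_reindex (@mincr_inj d j) _ (sjE j)) => m /mincr_range mj.
  by rewrite mulX0 // mulr0 mul0r.
have LE : has_sum (fun m => norm_weight t.+1 m * mulL (s < k)%N%:R (U s) h m *
  (g m)^*%R)
    ((s < k)%N%:R * s0 + -1 * \sum_j U s j * sj j).
  apply: has_sum_ext (has_sumD (has_sumZ (a := (s < k)%N%:R) s0E)
    (has_sumZ (a := -1)
    (has_sum_sum (r := index_enum _) (P := xpredT)
      (fun j _ => has_sumZ (a := U s j) (XE j))))) => m /=.
  rewrite /mulL mulrBr mulrBl mulN1r; congr (_ - _); first by ring.
  by rewrite mulr_sumr mulr_suml; apply: eq_bigr => j _; ring.
set X := _ * s0 + _ in LE.
suff SE : S = t.+1%:R * X by have -> : S / t.+1%:R = X by rewrite SE mulrC mulKf.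
apply: has_sum_unique hS _.
apply: has_sum_ext (has_sumZ (a := t.+1%:R)
  (has_sumD (has_sumZ (a := (s < k)%N%:R) s0E)
  (has_sumZ (a := -1) (has_sum_sum (r := index_enum _) (P := xpredT)
      (fun j _ => has_sumZ (a := U s j) (sjE j)))))) => m /=.
have -> : (diffD t.+1 (s < k)%N%:R (w s) g m)^*%R =
   (s < k)%N%:R * (t.+1%:R + (msize m)%:R) * (g m)^*%R - \sum_j q j * U s j *
     (dX j g m)^*%R.
  rewrite /diffD rmorphB !rmorphM rmorph_sum /= !conjC_nat natrD; congr (_ - _).
  apply: eq_bigr => j _; rewrite !rmorphM /= conjCK; congr (_ * _ * _).
  by rewrite conj_Creal // gtr0_real.
rewrite mulrBr mulrDr; congr (_ + _).
  transitivity ((s < k)%N%:R * h m * (g m)^*%R * (t.+1%:R * norm_weight t.+1 m));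
    first by ring.
  by rewrite norm_weight_raise; ring.
rewrite mulN1r mulrN mulr_sumr mulr_sumr; congr (- _); apply: eq_bigr => j _.
by rewrite mincr_shift_pair; field.
Qed.

Definition sqnorm n t : R[i] :=
  (mfact n)%:R * mpow kap n / poch t%:R (msize n) / c ^+ (t + msize n).

(** [L_s] raises [n] and its adjoint [D_s] lowers [n']. Pairings of distinct
    indices therefore reduce to one in which [D_s] meets an index with zero
    entry [s]; when [n] runs out before [n'], the two series are exchanged by
    complex conjugation. *)
Lemma orthogonality_gencoef n n' t :
  has_sum (fun m => norm_weight t.+1 m * gencoef k l U n t.+1 m *
    (gencoef k l U n' t.+1 m)^*%R)
    ((n == n')%:R * sqnorm n t.+1).
Proof.
have step i n1 n2 t1 S :
  has_sum (fun m => norm_weight t1.+2 m * gencoef k l U n1 t1.+2 m *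
    (gencoef k l U (mdecr n2 i) t1.+2 m)^*%R) S ->
  has_sum (fun m => norm_weight t1.+1 m * gencoef k l U (mincr n1 i) t1.+1 m *
    (gencoef k l U n2 t1.+1 m)^*%R)
    ((n2 i)%:R * kap i * S / t1.+1%:R).
  move=> hS; have := has_sumZ (a := (n2 i)%:R * kap i) hS => hS'.
  rewrite (_ : (fun m => _) = fun m => norm_weight t1.+1 m *
    mulL (i < k)%N%:R (U i) (gencoef k l U n1 t1.+2) m *
    (gencoef k l U n2 t1.+1 m)^*%R); last first.
    by apply/funext => m; rewrite gencoef_mincr.
  apply: adjoint_pair; [exact: tame_gencoef|exact: tame_gencoef|].
  apply: has_sum_ext hS' => m.
  rewrite (diffD_gencoef Uw sumw) !rmorphM /=
    conjC_nat (conj_Creal (kap_real i)); ring.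
have conjE n1 n2 t1 S :
  has_sum (fun m => norm_weight t1.+1 m * gencoef k l U n1 t1.+1 m *
    (gencoef k l U n2 t1.+1 m)^*%R) S ->
  has_sum (fun m => norm_weight t1.+1 m * gencoef k l U n2 t1.+1 m *
    (gencoef k l U n1 t1.+1 m)^*%R) (S^*)%R.
  move=> /has_sum_conj; apply: has_sum_ext => m;
    rewrite rmorphM /= conjCK rmorphM /=.
  by rewrite (conj_Creal (ger0_real (norm_weight_ge0 _ _))); ring.
have base t1 : has_sum (fun m => norm_weight t1.+1 m *
  gencoef k l U midx0 t1.+1 m * (gencoef k l U midx0 t1.+1 m)^*%R)
    (sqnorm midx0 t1.+1).
  have y1 : \sum_j `|cutoff l j * q j| < 1.
    rewrite (eq_bigr (fun j => cutoff l j * q j)); last first.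
      by move=> j _; rewrite ger0_norm // mulr_ge0 ?ler0n // ltW.
    by rewrite -subr_gt0 sumq.
  rewrite /sqnorm mfact0 mpow0 msize0 poch0 addn0 divr1 !mul1r -sumq.
  apply: has_sum_ext (has_sum_negbin (t := t1.+1) y1) => m.
  have -> : negbin (fun j => cutoff l j * q j) t1.+1 m =
    negbin (cutoff l) t1.+1 m * mpow q m.
    rewrite /negbin /egf -[RHS]mulrA; congr (_ * _); rewrite /mpow.
    by under eq_bigr do rewrite exprMn; rewrite big_split.
  rewrite gencoef0 conj_Creal; last first.
    by rewrite ger0_real // negbin_ge0 // => j; rewrite ler0n.
  have m0 := mfact_neq0 (R[i] : numFieldType) m; have p0 := poch_neq0 t1 (msize m).
  have cc : mpow (cutoff l) m * mpow (cutoff l) m = mpow (cutoff l) m :> R[i].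
    by rewrite mpow_cutoff; case: (_ == _); rewrite ?mulr1 ?mulr0.
  rewrite /norm_weight /negbin /egf -{1}cc; field.
  by rewrite m0 p0.
elim/mindex_ind: n n' t => [|n i IH] n' t.
  elim/mindex_ind: n' => [|r i _]; first by rewrite eqxx mul1r; exact: base.
  have [S hS] := has_sum_exists (dominated_pair t.+1 (tame_gencoef l k U r t.+2)
     (tame_gencoef l k U (mdecr midx0 i) t.+2)).
  have := conjE _ _ _ _ (step i _ _ _ _ hS); rewrite ffunE !mul0r conjC0.
  rewrite (_ : (_ == _) = false) ?mul0r //; apply/eqP => /ffunP/(_ i).
  by rewrite mincrE ffunE eqxx addn1.
have := step i _ _ _ _ (IH (mdecr n' i) t.+1).
have [n'i|n'i] := posnP (n' i).
  rewrite n'i !mul0r (_ : (_ == _) = false) ?mul0r //; apply/eqP => nn'.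
  by move: n'i; rewrite -nn' mincrE eqxx addn1.
have [r ->] : exists r, n' = mincr r i by exists (mdecr n' i); rewrite mdecrK.
rewrite mincrK (inj_eq (@mincr_inj d i)) mincrE eqxx addn1.
have [<-|_] := eqVneq n r; last by rewrite !mul0r mulr0 mul0r.
rewrite !mul1r; congr has_sum.
rewrite /sqnorm mfact_mincr mpow_mincr msize_mincr pochS natr1 natrM addnS -addSn.
have p0 := poch_neq0 t.+1 (msize n);
  have t0 : t.+1%:R != 0 :> R[i] by rewrite pnatr_eq0.
have c0 : c ^+ (t.+2 + msize n) != 0 by rewrite expf_neq0 // lt0r_neq0.
by field; rewrite nat1r t0 p0 c0.
Qed.

End Orthogonality.

(** * The matrix condition *)

Section UnitaryParameters.
Variables (K : numClosedFieldType) (d k l : nat).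
Variables (p pt : 'I_d -> K) (p0 : K) (U : 'M[K]_d).

Hypothesis p0_neq0 : p0 != 0.
Hypothesis p_ext : forall i : 'I_d, (k <= i)%N -> `|p i| ^+ 2 = `|p0| ^+ 2.
Hypothesis pt_ext : forall j : 'I_d, (l <= j)%N -> `|pt j| ^+ 2 = `|p0| ^+ 2.
Hypothesis UE : (Uhat k l U)^t* *m Cmx k p0 p *m Uhat k l U *m Cmx l p0 pt =
  (`|p0| ^+ 2)%:M.

(** A one-sided inverse of a square matrix is two-sided. *)
Lemma UE_swap :
  Uhat k l U *m Cmx l p0 pt *m (Uhat k l U)^t* *m Cmx k p0 p = (`|p0| ^+ 2)%:M.
Proof.
have c0 : `|p0| ^+ 2 != 0 by rewrite expf_neq0 // normr_eq0.
move: UE; set V := Uhat k l U; set C := Cmx k p0 p; set Ct := Cmx l p0 pt => VE.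
have : (`|p0| ^+ 2)^-1 *: (V^t* *m C) *m (V *m Ct) = 1%:M.
  by rewrite -scalemxAl mulmxA VE scale_scalar_mx mulVf.
move=> /mulmx1C; rewrite -scalemxAr mulmxA => /(congr1 (fun A => `|p0| ^+ 2 *: A)).
by rewrite scalerA mulfV // scale1r scale_scalar_mx mulr1.
Qed.

Lemma UhatE :
  [/\ forall i j, Uhat k l U (rshift 1 i) (rshift 1 j) = U i j,
      forall i, Uhat k l U (rshift 1 i) (lshift d ord0) = (i < k)%N%:R,
      forall j, Uhat k l U (lshift d ord0) (rshift 1 j) = (j < l)%N%:R &
      Uhat k l U (lshift d ord0) (lshift d ord0) = 1].
Proof.
by split=> [i j|i|j|]; rewrite /Uhat ?block_mxEdr ?block_mxEdl ?block_mxEur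
  ?block_mxEul // !mxE.
Qed.

Lemma Cmx_diag k' p' :
  (forall i : 'I_d, (k' <= i)%N -> `|p' i| ^+ 2 = `|p0| ^+ 2) ->
  Cmx k' p0 p' = diag_mx (row_mx 1%:M (\row_i (- `|p' i| ^+ 2))).
Proof.
move=> p'E; congr (diag_mx (row_mx _ _)); apply/rowP => i; rewrite !mxE.
by case: ltnP => // /p'E->.
Qed.

Lemma UE_entries r s :
  (Uhat k l U r (lshift d ord0) * (Uhat k l U s (lshift d ord0))^*%R -
   \sum_j Uhat k l U r (rshift 1 j) *
     (`|pt j| ^+ 2 * (Uhat k l U s (rshift 1 j))^*%R)) *
  row_mx 1%:M (\row_i (- `|p i| ^+ 2)) ord0 s = (r == s)%:R * `|p0| ^+ 2.
Proof.
have := UE_swap; rewrite (Cmx_diag p_ext) (Cmx_diag pt_ext) !mul_mx_diag => VE.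
rewrite (_ : (r == s)%:R * `|p0| ^+ 2 = (`|p0| ^+ 2)%:M r s);
  last by rewrite mxE mulr_natl.
rewrite -VE [RHS]mxE; congr (_ * _); move: (Uhat k l U) => V.
have trE x y : (V^t*) x y = (V y x)^*%R by rewrite !mxE.
rewrite [RHS]mxE big_split_ord big_ord1 /= trE mxE row_mxEl mxE mulr1.
congr (_ + _); rewrite -sumrN; apply: eq_bigr => j _.
by rewrite trE mxE row_mxEr mxE; ring.
Qed.

Lemma Cmx_entry i : row_mx 1%:M (\row_i (- `|p i| ^+ 2)) ord0 (rshift 1 i) =
  - `|p i| ^+ 2.
Proof. by rewrite row_mxEr mxE. Qed.

(** Otherwise a column of the matrix product would vanish. *)
Lemma p_neq0 i : p i != 0.
Proof.
have := UE_entries (rshift 1 i) (rshift 1 i).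
rewrite eqxx mul1r Cmx_entry => pE; apply: contra_neq p0_neq0 => pi0.
move/esym/eqP: pE; rewrite pi0 normr0 expr0n oppr0 mulr0 expf_eq0 /= normr_eq0.
by move/eqP.
Qed.

(** The entries of [Uhat Ct Uhat^* C = |p_0|^2] away from the first row and
    column are [Uw], and those in the first row are [sumw], for the
    constants [kap s = |p_0 / p_s|^2]. *)
Lemma Uw_relation (r s : 'I_d) :
  (s < k)%N%:R * (r < k)%N%:R - \sum_j U r j * (`|pt j| ^+ 2 * (U s j)^*%R) =
  - ((r == s)%:R * (`|p0| ^+ 2 / `|p s| ^+ 2)).
Proof.
have [U1 U2 _ _] := UhatE; have := UE_entries (rshift 1 r) (rshift 1 s).
rewrite Cmx_entry !U2 (inj_eq (@rshift_inj _ _)) conjC_nat.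
under eq_bigr do rewrite !U1.
have pn : `|p s| ^+ 2 != 0 by rewrite expf_neq0 // normr_eq0 p_neq0.
move=> /(canRL (mulfK _)); rewrite oppr_eq0 => /(_ pn) eqX.
by rewrite [X in X - _]mulrC eqX invrN; ring.
Qed.

Lemma sumw_relation (s : 'I_d) :
  (s < k)%N%:R - \sum_j cutoff l j * (`|pt j| ^+ 2 * (U s j)^*%R) = 0.
Proof.
have [U1 U2 U3 U4] := UhatE; have := UE_entries (lshift d ord0) (rshift 1 s).
rewrite Cmx_entry U2 U4 conjC_nat eq_lrshift mul0r mul1r.
under eq_bigr do rewrite U1 U3.
move=> /eqP; rewrite mulf_eq0 oppr_eq0 expf_eq0 /=
  normr_eq0 (negbTE (p_neq0 s)) orbF.
by move=> /eqP.
Qed.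

(** The complex conjugate of [UE_swap]: the hypotheses are symmetric under
    exchanging [(k, p)] with [(l, pt)] and transposing [U]. *)
Lemma UE_transpose :
  (Uhat l k U^T)^t* *m Cmx l p0 pt *m Uhat l k U^T *m Cmx k p0 p = (`|p0| ^+ 2)%:M.
Proof.
have -> : Uhat l k U^T = (Uhat k l U)^T.
  by rewrite /Uhat tr_block_mx trmx1 !trmxK.
have conjCmx k' p' : map_mx Num.conj (Cmx k' p0 p') = Cmx k' p0 p'.
  rewrite /Cmx map_diag_mx map_row_mx map_mx1; congr (diag_mx (row_mx _ _)).
  apply/rowP => i; rewrite !mxE; case: ifP => _; rewrite rmorphN rmorphXn /=;
  by rewrite conj_Creal // normr_real.
have := congr1 (map_mx Num.conj) UE_swap.
rewrite !map_mxM !conjCmx map_scalar_mx /= rmorphXn /= (conj_Creal (normr_real _)).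
by rewrite trmxK (_ : map_mx Num.conj (_ ^t*) = (Uhat k l U)^T) //;
  apply/matrixP => i j; rewrite !mxE conjCK.
Qed.

End UnitaryParameters.

(** * The theorem *)

(** The second orthogonality relation, under hypotheses that are preserved by
    exchanging [(k, p)] with [(l, pt)] and transposing [U], so that the first
    relation is an instance too. *)
Lemma hmeixner_orthogonal (R : realType) (d k l t : nat) (p pt : 'I_d -> R[i])
    (p0 : R[i]) (U : 'M[R[i]]_d) :
  p0 != 0 ->
  (forall i : 'I_d, (k <= i)%N -> `|p i| ^+ 2 = `|p0| ^+ 2) ->
  (forall j : 'I_d, (l <= j)%N -> `|pt j| ^+ 2 = `|p0| ^+ 2) ->
  1 - \sum_(j < d | (j < l)%N) `|pt j| ^+ 2 = `|p0| ^+ 2 ->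
  (Uhat k l U)^t* *m Cmx k p0 p *m Uhat k l U *m Cmx l p0 pt =
    (`|p0| ^+ 2)%:M ->
  let M : mindex d -> mindex d -> R[i] := hmeixner k l t.+1%:R U in
  forall n n' : mindex d,
      has_sum
        (fun m : mindex d =>
           poch t.+1%:R (msize m) / (mfact m)%:R *
           mpow pt m * mpow (fun j => (pt j)^*%R) m * M m n * (M m n')^*%R)
        ((n == n')%:R *
         ((mfact n)%:R * mpowV p n * mpowV (fun i => (p i)^*%R) n /
          (poch t.+1%:R (msize n) * `|p0| ^+ (2 * t.+1)))).
Proof.
move=> p0_neq0 p_ext pt_ext pt_sum UE M n n'.
have ptn := p_neq0 p0_neq0 pt_ext p_ext (UE_transpose p0_neq0 UE).
have c_gt0 : 0 < `|p0| ^+ 2 by rewrite exprn_gt0 // normr_gt0.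
have q_gt0 j : 0 < `|pt j| ^+ 2 by rewrite exprn_gt0 // normr_gt0.
pose kap (s : 'I_d) := `|p0| ^+ 2 / `|p s| ^+ 2.
have kap_real s : kap s \is Num.real.
  by rewrite ger0_real // divr_ge0 // exprn_ge0.
have sumq : 1 - \sum_j cutoff l j * `|pt j| ^+ 2 = `|p0| ^+ 2.
  rewrite -pt_sum [in RHS]big_mkcond; congr (_ - _); apply: eq_bigr => j _.
  by rewrite /cutoff; case: ifP; rewrite ?mul1r ?mul0r.
have := orthogonality_gencoef (n := n) (n' := n') (t := t) q_gt0 c_gt0 kap_real sumq
  (Uw_relation p0_neq0 p_ext pt_ext UE) (sumw_relation p0_neq0 p_ext pt_ext UE).
have -> : sqnorm kap (`|p0| ^+ 2) n t.+1 =
    (mfact n)%:R * mpowV p n * mpowV (fun i => (p i)^*%R) n /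
          (poch t.+1%:R (msize n) * `|p0| ^+ (2 * t.+1)).
  have kapE : mpow kap n =
      (`|p0| ^+ 2) ^+ msize n * (mpowV p n * mpowV (fun i => (p i)^*%R) n).
    rewrite /msize expr_sum /mpowV -!big_split; apply: eq_bigr => i _ /=.
    by rewrite /kap (normCK (p i)) expr_div_n; congr (_ * _); rewrite exprMn invfM.
  rewrite /sqnorm kapE exprD exprM.
  have cM : (`|p0| ^+ 2) ^+ msize n != 0 by rewrite expf_neq0 // lt0r_neq0.
  have ct : (`|p0| ^+ 2) ^+ t.+1 != 0 by rewrite expf_neq0 // lt0r_neq0.
  have pp := poch_neq0 R t (msize n).
  move: cM ct; move: (_ ^+ msize n) (_ ^+ t.+1) => X Y cM ct.
  by field; rewrite pp cM ct.
apply: has_sum_ext => m; rewrite !gencoef_hmeixner -/M.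
have -> : (poch t.+1%:R (msize m) / (mfact m)%:R * M m n')^*%R =
   poch t.+1%:R (msize m) / (mfact m)%:R * (M m n')^*%R.
  rewrite rmorphM /= conj_Creal // ger0_real // divr_ge0 ?poch_ge0 ?ler0n //.
have -> : norm_weight (fun j => `|pt j| ^+ 2) t.+1 m =
    (mfact m)%:R / poch t.+1%:R (msize m) *
    (mpow pt m * mpow (fun j => (pt j)^*%R) m).
  rewrite /norm_weight; congr (_ * _); rewrite /mpow -big_split;
    apply: eq_bigr => j _ /=.
  by rewrite normCK exprMn.
have pp := poch_neq0 R t (msize m).
have mm := mfact_neq0 (R[i] : numFieldType) m.
by field; rewrite pp mm.
Qed.

Theorem theorem5p2 (R : realType) (d k l sigma : nat)
    (p pt : 'I_d -> R[i]) (p0 a : R[i]) (U : 'M[R[i]]_d)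
    (d_ge1 : (1 <= d)%N) (k_bounds : (1 <= k <= d)%N)
    (l_bounds : (1 <= l <= d)%N) (sigma_ge : (d + 1 <= sigma)%N)
    (p_pt : \sum_(i < d | (i < k)%N) `|p i| ^+ 2 =
            \sum_(j < d | (j < l)%N) `|pt j| ^+ 2)
    (p_lt1 : \sum_(i < d | (i < k)%N) `|p i| ^+ 2 < 1)
    (p0E : `|p0| ^+ 2 = 1 - \sum_(i < d | (i < k)%N) `|p i| ^+ 2)
    (UE : (Uhat k l U)^t* *m Cmx k p0 p *m Uhat k l U *m Cmx l p0 pt =
          (`|p0| ^+ 2)%:M)
    (aE : `|a| ^- 2 = `|p0| ^+ 2)
    (p_ext : forall i : 'I_d, (k <= i)%N -> p i = 1 / a)
    (pt_ext : forall j : 'I_d, (l <= j)%N -> pt j = 1 / a) :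
  let M : mindex d -> mindex d -> R[i] := hmeixner k l sigma%:R U in
  let chi (s : 'I_d) : R[i] := (s < k)%N%:R in
  (* orthogonality relations *)
  ((forall m m' : mindex d,
      has_sum
        (fun n : mindex d =>
           poch sigma%:R (msize n) / (mfact n)%:R *
           mpow p n * mpow (fun i => (p i)^*%R) n * M m n * (M m' n)^*%R)
        ((m == m')%:R *
         ((mfact m)%:R * mpowV pt m * mpowV (fun j => (pt j)^*%R) m /
          (poch sigma%:R (msize m) * `|p0| ^+ (2 * sigma))))) /\
   (forall n n' : mindex d,
      has_sum
        (fun m : mindex d =>
           poch sigma%:R (msize m) / (mfact m)%:R *
           mpow pt m * mpow (fun j => (pt j)^*%R) m * M m n * (M m n')^*%R)
        ((n == n')%:R *
         ((mfact n)%:R * mpowV p n * mpowV (fun i => (p i)^*%R) n /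
          (poch sigma%:R (msize n) * `|p0| ^+ (2 * sigma)))))) /\
  (* generating function *)
  (exists2 eps : R, 0 < eps &
     forall (t : 'I_d -> R[i]), (forall j, `|t j| < eps%:C) ->
     forall n : mindex d,
       has_sum
         (fun m : mindex d =>
            poch sigma%:R (msize m) / (mfact m)%:R * M m n * mpow t m)
         ((1 - \sum_(j < d | (j < l)%N) t j) ^- (sigma + msize n) *
          (\prod_(i < d | (i < k)%N) (1 - \sum_(j < d) U i j * t j) ^+ n i) *
          (\prod_(i < d | (k <= i)%N) (- \sum_(j < d) U i j * t j) ^+ n i))) /\
  (* duality *)
  (forall m n : mindex d, M m n = hmeixner l k sigma%:R U^T n m) /\
  (* difference equations *)
  (forall (s : 'I_d) (m n : mindex d),
     `|p0 / p s| ^+ 2 * (n s)%:R * M m n =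
     (chi s * (sigma%:R + (msize m)%:R) +
      \sum_(i < d) `|U s i * pt i| ^+ 2 * (m i)%:R) * M m n +
     \sum_(i < d) \sum_(j < d | i != j)
       (U s i)^*%R * U s j * `|pt i| ^+ 2 * (m j)%:R *
       M (mincr (mdecr m j) i) n -
     chi s *
     (\sum_(i < d) U s i * (m i)%:R * M (mdecr m i) n +
      (sigma%:R + (msize m)%:R) *
      \sum_(i < d) (U s i)^*%R * `|pt i| ^+ 2 * M (mincr m i) n)).
Proof.
move=> M chi.
have c_gt0 : 0 < `|p0| ^+ 2 by rewrite p0E subr_gt0.
have p0_neq0 : p0 != 0.
  by apply: contraTneq c_gt0 => ->; rewrite normr0 expr0n ltxx.
have aE' : `|1 / a| ^+ 2 = `|p0| ^+ 2 by rewrite div1r normfV exprVn.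
have p_norm (i : 'I_d) : (k <= i)%N -> `|p i| ^+ 2 = `|p0| ^+ 2.
  by move=> /p_ext->.
have pt_norm (j : 'I_d) : (l <= j)%N -> `|pt j| ^+ 2 = `|p0| ^+ 2.
  by move=> /pt_ext->.
have pt_sum : 1 - \sum_(j < d | (j < l)%N) `|pt j| ^+ 2 = `|p0| ^+ 2.
  by rewrite -p_pt -p0E.
case: sigma sigma_ge @M => [|t] sigma_ge M; first by rewrite addn1 in sigma_ge.
have dual m n : M m n = hmeixner l k t.+1%:R U^T n m by apply: hmeixner_dual.
split; [split|split; [|split]].
- move=> m m'.
  have := hmeixner_orthogonal (t := t) (n := m) (n' := m') p0_neq0 pt_norm p_norm
    (esym p0E) (UE_transpose p0_neq0 UE).
  by apply: has_sum_ext => n; rewrite !dual.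
- exact: hmeixner_orthogonal.
(* With this radius the moduli of the d variables have sum less than 1. *)
- exists (d.+1%:R^-1); first by rewrite invr_gt0 ltr0n.
  move=> x x_small n.
  have x1 : \sum_j `|cutoff l j * x j| < 1.
    apply: (@le_lt_trans _ _ (\sum_(j < d) (d.+1%:R : R[i])^-1)).
      apply: ler_sum => j _; apply: (@le_trans _ _ `|x j|).
        by rewrite normrM ler_piMl // /cutoff normr_nat lern1 leq_b1.
      by apply: ltW; have := x_small j;
        rewrite rmorphV ?unitfE ?pnatr_eq0 //= rmorph_nat.
    rewrite sumr_const card_ord -[_ *+ d]mulr_natr mulrC.
    by rewrite ltr_pdivrMr ?ltr0n // mul1r ltr_nat.
  have := has_sum_gencoef (k := k) (U := U) (n := n) (t := t.+1) x1.
  rewrite (_ : \prod_(i < d) _ =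
    (\prod_(i < d | (i < k)%N) (1 - \sum_(j < d) U i j * x j) ^+ n i) *
    (\prod_(i < d | (k <= i)%N) (- \sum_(j < d) U i j * x j) ^+ n i)); last first.
    rewrite (bigID (fun i : 'I_d => (i < k)%N)) /=; congr (_ * _).
      by apply: eq_bigr => i ->.
    apply: eq_big => [i|i /negbTE->]; first by rewrite -leqNgt.
    by rewrite sub0r.
  rewrite (_ : \sum_j cutoff l j * x j = \sum_(j < d | (j < l)%N) x j); last first.
    rewrite [RHS]big_mkcond; apply: eq_bigr => j _.
    by rewrite /cutoff; case: ifP; rewrite ?mul1r ?mul0r.
  rewrite mulrA; apply: has_sum_ext => m.
  by rewrite gencoef_hmeixner.
- exact: dual.
- move=> s m n.
  have := hmeixner_difference (w := fun s i => `|pt i| ^+ 2 * (U s i)^*%R)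
    (Uw_relation p0_neq0 p_norm pt_norm UE)
    (sumw_relation p0_neq0 p_norm pt_norm UE) t s m n.
  rewrite /= -/M -/(chi s) normf_div expr_div_n => ->.
  congr (_ + _ - _ * (_ + _ * _)).
  + congr ((_ + _) * _); apply: eq_bigr => i _.
    by rewrite normrM exprMn (normCK (U s i)); ring.
  + by apply: eq_bigr => i _; apply: eq_bigr => j _; ring.
  + by apply: eq_bigr => i _; ring.
Qed.
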